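(* Let $D$ be a finite domain and let $\Gamma$ be a finite family of promise relations over $D$. Then there exist directed graphs $H_\Gamma$ and $H'_\Gamma$ such that $H_\Gamma$ is a subgraph of $H'_\Gamma$ (so in particular there is a homomorphism $H_\Gamma\to H'_\Gamma$) and $\operatorname{PCSP}(\Gamma)$ is polynomial-time equivalent to $\mathsf{PDGH}(H_\Gamma,H'_\Gamma)$.
   Context: A promise relation over $D$ is a pair $(P,Q)$ with $P\subseteq Q\subseteq D^k$. An instance of $\operatorname{PCSP}(\Gamma)$ on variables $x_1,\dots,x_n$ is a list of clauses, each consisting of some $(P,Q)\in\Gamma$ of arity $k$ and a $k$-tuple of variables (repetitions allowed); $\Psi_P$ (resp. $\Psi_Q$) is the conjunction of the $P$- (resp. corresponding $Q$-) constraints. $\operatorname{PCSP}(\Gamma)$ is the promise problem: output YES if $\Psi_P$ is satisfiable, NO if $\Psi_Q$ is unsatisfiable. For directed graphs $H,H'$ with a homomorphism $H\to H'$, $\mathsf{PDGH}(H,H')$ is the promise problem: given a directed graph $G$, output YES if there is a homomorphism from $G$ to $H$ and NO if there is no homomorphism from $G$ to $H'$. *)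

(* Defs.v *)
From Stdlib Require Import BinNat BinPos.
From HB Require Import structures.
From mathcomp Require Import all_boot.
Set Implicit Arguments. Unset Strict Implicit. Unset Printing Implicit Defensive.

Inductive dir := MoveL | MoveR | Stay.

Record TM := {
  tm_Q : finType;
  tm_G : finType;
  tm_blank : tm_G;
  tm_in : bool -> tm_G;
  tm_out : tm_G -> option bool;
  tm_start : tm_Q;
  tm_halt : tm_Q -> bool;
  tm_delta : tm_Q -> tm_G -> tm_Q * tm_G * dir }.
Arguments tm_blank : clear implicits.
Arguments tm_in : clear implicits.
Arguments tm_out : clear implicits.
Arguments tm_start : clear implicits.
Arguments tm_halt : clear implicits.
Arguments tm_delta : clear implicits.

(* configuration: state, tape left of head (nearest cell first),
   scanned symbol, tape right of head *)
Definition config (M : TM) := (tm_Q M * seq (tm_G M) * tm_G M * seq (tm_G M))%type.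

Definition tm_init (M : TM) (x : seq bool) : config M :=
  match map (tm_in M) x with
  | [::] => (tm_start M, [::], tm_blank M, [::])
  | g :: s => (tm_start M, [::], g, s)
  end.

Definition tm_step (M : TM) (c : config M) : config M :=
  let: (q, l, g, r) := c in
  if tm_halt M q then c else
  let: (q', w, d) := tm_delta M q g in
  match d with
  | Stay => (q', l, w, r)
  | MoveL => match l with
             | [::] => (q', [::], tm_blank M, w :: r)
             | h :: l' => (q', l', h, w :: r)
             end
  | MoveR => match r with
             | [::] => (q', w :: l, tm_blank M, [::])
             | h :: r' => (q', w :: l, h, r')
             end
  end.

(* output: the maximal sequence of output bits starting at the head *)
Fixpoint tm_decode (M : TM) (s : seq (tm_G M)) : seq bool :=
  match s with
  | [::] => [::]
  | g :: s' => match tm_out M g with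
               | Some b => b :: tm_decode s'
               | None => [::]
               end
  end.

Definition tm_computes_in (M : TM) (x y : seq bool) (t : nat) : Prop :=
  let: (q, l, g, r) := iter t (@tm_step M) (tm_init M x) in
  tm_halt M q /\ tm_decode (g :: r) = y.

Definition poly_time_computable (f : seq bool -> seq bool) : Prop :=
  exists (M : TM) (c : nat), forall x : seq bool,
    exists t, t <= (size x) ^ c + c /\ tm_computes_in M x (f x) t.

Record promise_problem := { pp_yes : seq bool -> Prop; pp_no : seq bool -> Prop }.

Definition ptime_reduces (A B : promise_problem) : Prop :=
  exists f, poly_time_computable f /\
    forall x, (pp_yes A x -> pp_yes B (f x)) /\ (pp_no A x -> pp_no B (f x)).

Definition ptime_equivalent (A B : promise_problem) : Prop :=
  ptime_reduces A B /\ ptime_reduces B A.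

Fixpoint pos_bits (p : positive) : seq bool :=
  match p with
  | xH => [:: true]
  | xO p' => false :: pos_bits p'
  | xI p' => true :: pos_bits p'
  end.

Definition nat_bits (n : nat) : seq bool :=
  match N.of_nat n with N0 => [::] | Npos p => pos_bits p end.

(* binary, self-delimiting: each bit b as [true; b], terminated by false *)
Definition enc_nat (n : nat) : seq bool :=
  flatten [seq [:: true; b] | b <- nat_bits n] ++ [:: false].

Definition enc_unary (n : nat) : seq bool := nseq n true ++ [:: false].

Definition enc_list (T : Type) (e : T -> seq bool) (s : seq T) : seq bool :=
  flatten [seq true :: e x | x <- s] ++ [:: false].

Record prel (D : finType) := {
  pr_ar : nat;
  pr_P : {set pr_ar.-tuple D};
  pr_Q : {set pr_ar.-tuple D};
  pr_PQ : pr_P \subset pr_Q }.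

(* An instance of PCSP(Gamma) on variables x_0..x_{n-1}: a list of clauses,
   each a relation index in Gamma and a list of variables. *)
Record pcsp_inst (D : finType) (Gam : seq (prel D)) := {
  pi_n : nat;
  pi_cl : seq ('I_(size Gam) * seq 'I_pi_n) }.

Definition pcsp_wf (D : finType) (Gam : seq (prel D)) (I : @pcsp_inst D Gam) : Prop :=
  forall c, c \in pi_cl I -> size c.2 = pr_ar (tnth (in_tuple Gam) c.1).

Definition tuple_in (D : finType) (k : nat) (R : {set k.-tuple D}) (s : seq D) : Prop :=
  exists t : k.-tuple D, t \in R /\ val t = s.

Definition sat_P (D : finType) (Gam : seq (prel D)) (I : @pcsp_inst D Gam) : Prop :=
  exists a : 'I_(pi_n I) -> D, forall c, c \in pi_cl I ->
    tuple_in (pr_P (tnth (in_tuple Gam) c.1)) (map a c.2).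

Definition sat_Q (D : finType) (Gam : seq (prel D)) (I : @pcsp_inst D Gam) : Prop :=
  exists a : 'I_(pi_n I) -> D, forall c, c \in pi_cl I ->
    tuple_in (pr_Q (tnth (in_tuple Gam) c.1)) (map a c.2).

Definition enc_pcsp (D : finType) (Gam : seq (prel D)) (I : @pcsp_inst D Gam) : seq bool :=
  enc_unary (pi_n I) ++
  enc_list (fun c : 'I_(size Gam) * seq 'I_(pi_n I) =>
              enc_nat (val c.1) ++ enc_list enc_nat (map val c.2)) (pi_cl I).

Definition PCSP (D : finType) (Gam : seq (prel D)) : promise_problem := {|
  pp_yes := fun x => exists I : pcsp_inst Gam, x = enc_pcsp I /\ pcsp_wf I /\ sat_P I;
  pp_no := fun x => exists I : pcsp_inst Gam, x = enc_pcsp I /\ pcsp_wf I /\ ~ sat_Q I |}.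

Record in_digraph := { dg_n : nat; dg_E : seq ('I_dg_n * 'I_dg_n) }.

Definition enc_digraph (G : in_digraph) : seq bool :=
  enc_unary (dg_n G) ++
  enc_list (fun e : 'I_(dg_n G) * 'I_(dg_n G) =>
              enc_nat (val e.1) ++ enc_nat (val e.2)) (dg_E G).

Definition dg_hom (G : in_digraph) (V : finType) (E : rel V) : Prop :=
  exists f : 'I_(dg_n G) -> V, forall e, e \in dg_E G -> E (f e.1) (f e.2).

Definition PDGH (V : finType) (E : rel V) (V' : finType) (E' : rel V')
  : promise_problem := {|
  pp_yes := fun x => exists G, x = enc_digraph G /\ dg_hom G E;
  pp_no := fun x => exists G, x = enc_digraph G /\ ~ dg_hom G E' |}.

(* Main.v *)
From Stdlib Require Import BinNat BinPos Classical.
Require Import Defs.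
From HB Require Import structures.
From mathcomp Require Import all_boot zify.
Set Implicit Arguments. Unset Strict Implicit. Unset Printing Implicit Defensive.

(* Fix a finite digraph T of types: a long directed path together with types for
   clauses, for coordinates of clauses and for variables, each anchored to the path
   so that arc consistency identifies it.  A vertex of H is a nonempty set A of types
   with some data over D; A -> B is allowed when A and B are arc-consistent, and data
   are constrained only at singletons: a tuple of P at a clause type (of Q for H'),
   a value at a coordinate or variable type, with matching entries along arcs.

   From an instance to a digraph: put one copy of the path, and anchor to it one
   vertex per variable, clause and coordinate.  The anchors force singletons, hence
   the data of a homomorphism are a satisfying assignment.

   From a digraph G to an instance: run arc consistency of G against T.  The sets
   occurring in any homomorphism G -> H are contained in the computed ones, and
   enlarging a set only drops constraints, so one may assume that the computed sets
   are used.  What remains is to choose data at the singletons, which is an instance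
   of PCSP(Gamma) once variables forced to be equal are merged.  If a computed set is
   empty, the output is a fixed NO instance; if PCSP(Gamma) has no NO instance, take a
   single loop for H and H'.

   For the running times, polynomial-time functions on binary trees are shown to be
   closed under composition, pairing, case distinction and size-bounded iteration, by
   programs for a machine with four stacks that a one-tape Turing machine simulates
   with quadratic slowdown. *)

(** The obstacle is that an arbitrary digraph [G] need not resemble a digraph built from an
    instance: its vertices may fit several types or none, so it cannot simply be decoded. Letting a
    vertex of the target carry a set of types absorbs every ambiguity. A set with more than one
    element has no label, so it imposes nothing on the data. The sets depend only on the type
    digraph, not on the relations, so one map handles [P] and [Q] at once and sends YES to YES and
    NO to NO.

    Digraphs have no unary relations to mark vertices with, which is why the path is there. A label
    [t] is reached from [code t] and left towards [code t + 3]: the detour has two arcs where the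
    path has three, so no path vertex has both of these neighbours, while the path stays the only
    longest one.

    On the machine side, a single-tape Turing machine composes badly, so all programming is done
    with stack fragments and then with functions on trees. Closure under iteration requires a
    polynomial bound on every intermediate value, and this bound is the side condition that recurs
    in the running-time proofs. *)

(** * Program fragments for a machine with four stacks *)

Variant track := TrM | TrA | TrB | TrC.

Definition track_eqb (i j : track) : bool :=
  match i, j with
  | TrM, TrM | TrA, TrA | TrB, TrB | TrC, TrC => true
  | _, _ => false
  end.

Lemma track_eqP i j : reflect (i = j) (track_eqb i j).
Proof. by case: i; case: j; constructor. Qed.

Definition quad (X : Type) : Type := (X * X * X * X)%type.

Definition qget (X : Type) (i : track) (s : quad X) : X :=
  let: (m, a, b, c) := s in
  match i with TrM => m | TrA => a | TrB => b | TrC => c end.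

Definition qset (X : Type) (i : track) (v : X) (s : quad X) : quad X :=
  let: (m, a, b, c) := s in
  match i with
  | TrM => (v, a, b, c) | TrA => (m, v, b, c)
  | TrB => (m, a, v, c) | TrC => (m, a, b, v)
  end.

Lemma qget_set (X : Type) i j (v : X) s :
  qget j (qset i v s) = if track_eqb i j then v else qget j s.
Proof. by case: s => [[[m a] b] c]; case: i; case: j. Qed.

Lemma qset_get (X : Type) i (s : quad X) : qset i (qget i s) s = s.
Proof. by case: s => [[[m a] b] c]; case: i. Qed.

Notation store := (quad (seq bool)).

Inductive instr (Q : Type) :=
  | Jump of Q
  | Push of track & bool & Q
  | Pop of track & (option bool -> Q).

Definition instr_map (Q Q' : Type) (f : Q -> Q') (a : instr Q) : instr Q' :=
  match a with
  | Jump q => Jump (f q)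
  | Push i b q => Push i b (f q)
  | Pop i k => Pop i (fun o => f (k o))
  end.

Definition instr_exec (Q : Type) (a : instr Q) (s : store) : Q * store :=
  match a with
  | Jump q => (q, s)
  | Push i b q => (q, qset i (b :: qget i s) s)
  | Pop i k => (k (ohead (qget i s)), qset i (behead (qget i s)) s)
  end.

Lemma instr_exec_map (Q Q' : Type) (f : Q -> Q') a s :
  instr_exec (instr_map f a) s = (f (instr_exec a s).1, (instr_exec a s).2).
Proof. by case: a. Qed.

(** A flow graph whose exits carry a value in [X]. The value lets control depend on what was read,
    so that fragments compose as in a monad ([fret], [fbind]) and loop on an [option] result. *)
Record frag (X : Type) := Frag {
  fr_Q : finType;
  fr_start : fr_Q;
  fr_delta : fr_Q -> instr (fr_Q + X) }.

Inductive steps (X : Type) (A : frag X) :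
  fr_Q A + X -> store -> fr_Q A + X -> store -> nat -> Prop :=
  | steps_refl c s : steps c s c s 0
  | steps_step q s c' s' t :
      steps (instr_exec (fr_delta q) s).1 (instr_exec (fr_delta q) s).2 c' s' t ->
      steps (inl q) s c' s' t.+1.

Definition runs (X : Type) (A : frag X) (s : store) (x : X) (s' : store) (t : nat) :=
  exists2 t', t' <= t & steps (inl (fr_start A)) s (inr x) s' t'.

Lemma runs_leq (X : Type) (A : frag X) s x s' t1 t2 :
  t1 <= t2 -> runs A s x s' t1 -> runs A s x s' t2.
Proof. by move=> le12 [t le_t st]; exists t => //; apply: leq_trans le12. Qed.

Lemma steps_trans (X : Type) (A : frag X) (c1 c2 c3 : fr_Q A + X) s1 s2 s3 t1 t2 :
  steps c1 s1 c2 s2 t1 -> steps c2 s2 c3 s3 t2 -> steps c1 s1 c3 s3 (t1 + t2).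
Proof.
move=> st12; elim: st12 => [//|q s c' s' t _ IH] st; rewrite addSn.
exact/steps_step/IH.
Qed.

(** Transports a run along an embedding of flow graphs. Exits of [A] may become internal states of
    [B], which is how [fbind] enters its continuation and how [floop] restarts its body. *)
Lemma steps_map (X Y : Type) (A : frag X) (B : frag Y) (f : fr_Q A + X -> fr_Q B + Y) :
  (forall q, exists2 q', f (inl q) = inl q' &
     fr_delta q' = instr_map f (fr_delta q)) ->
  forall c s c' s' t, steps c s c' s' t -> steps (f c) s (f c') s' t.
Proof.
move=> f_inl c s c' s' t; elim=> [c1 s1|q s1 c1 s1' t1 _ IH]; first exact: steps_refl.
by have [q' -> dq'] := f_inl q; apply: steps_step; rewrite dq' instr_exec_map.
Qed.

Definition fret (X : Type) (x : X) : frag X :=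
  @Frag X unit tt (fun _ => Jump (inr x)).

Definition fpush (i : track) (b : bool) : frag unit :=
  @Frag unit unit tt (fun _ => Push i b (inr tt)).

Definition fpop (i : track) : frag (option bool) :=
  @Frag (option bool) unit tt (fun _ => Pop i (fun o => inr o)).

Section Bind.
Variables (X : finType) (Y : Type) (A : frag X) (K : X -> frag Y).

Definition bind_Q : finType := (fr_Q A + {x : X & fr_Q (K x)})%type.

Definition bind_right (x : X) (c : fr_Q (K x) + Y) : bind_Q + Y :=
  match c with
  | inl q => inl (inr (existT (fun x => fr_Q (K x) : Type) x q))
  | inr y => inr y
  end.

Definition bind_left (c : fr_Q A + X) : bind_Q + Y :=
  match c with
  | inl q => inl (inl q)
  | inr x => bind_right (inl (fr_start (K x)))
  end.

Definition fbind : frag Y :=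
  @Frag Y bind_Q (inl (fr_start A)) (fun q =>
    match q with
    | inl q => instr_map bind_left (fr_delta q)
    | inr (existT x q) => instr_map (@bind_right x) (fr_delta q)
    end).

Lemma runs_bind s x s' y s'' t1 t2 :
  runs A s x s' t1 -> runs (K x) s' y s'' t2 -> runs fbind s y s'' (t1 + t2).
Proof.
move=> [t1' le1 st1] [t2' le2 st2]; exists (t1' + t2'); first exact: leq_add.
have liftL : steps (A := fbind) (bind_left (inl (fr_start A))) s (bind_left (inr x)) s' t1'.
  by apply: (steps_map (f := bind_left : _ -> fr_Q fbind + Y)) st1 => q; exists (inl q).
apply: (steps_trans liftL).
by apply: (steps_map (B := fbind) (f := @bind_right x : _ -> fr_Q fbind + Y)) st2 => q;
   eexists.
Qed.
End Bind.

Section Loop.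
Variables (Y : Type) (A : frag (option Y)).

Definition loop_map (c : fr_Q A + option Y) : fr_Q A + Y :=
  match c with
  | inl q => inl q
  | inr None => inl (fr_start A)
  | inr (Some y) => inr y
  end.

Definition floop : frag Y :=
  @Frag Y (fr_Q A) (fr_start A) (fun q => instr_map loop_map (fr_delta q)).

Lemma runs_loop_body s o s' t :
  runs A s o s' t ->
  exists2 t', t' <= t & steps (A := floop) (inl (fr_start A)) s (loop_map (inr o)) s' t'.
Proof.
move=> [t' le st]; exists t' => //.
by apply: (steps_map (B := floop) (f := loop_map : _ -> fr_Q floop + Y)) st => q; exists q.
Qed.

Lemma runs_loop_stop s y s' t : runs A s (Some y) s' t -> runs floop s y s' t.
Proof. exact: runs_loop_body. Qed.

Lemma runs_loop_next s s' y s'' t1 t2 :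
  runs A s None s' t1 -> runs floop s' y s'' t2 -> runs floop s y s'' (t1 + t2).
Proof.
move=> /runs_loop_body[t1' le1 st1] [t2' le2 st2].
by exists (t1' + t2'); [exact: leq_add | exact: steps_trans st2].
Qed.
End Loop.

Lemma runs_ret (X : Type) (x : X) s : runs (fret x) s x s 1.
Proof. by exists 1 => //; apply: steps_step; apply: steps_refl. Qed.

Lemma runs_push i b s : runs (fpush i b) s tt (qset i (b :: qget i s) s) 1.
Proof. by exists 1 => //; apply: steps_step; apply: steps_refl. Qed.

Lemma runs_pop i s :
  runs (fpop i) s (ohead (qget i s)) (qset i (behead (qget i s)) s) 1.
Proof. by exists 1 => //; apply: steps_step; apply: steps_refl. Qed.

Definition height (s : store) : nat :=
  let: (m, a, b, c) := s in size m + size a + size b + size c.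

Lemma size_qget i s : size (qget i s) <= height s.
Proof. by case: s => [[[m a] b] c]; case: i => /=; lia. Qed.

Lemma height_exec (Q : Type) (a : instr Q) s : height (instr_exec a s).2 <= (height s).+1.
Proof.
case: s => [[[m a'] b] c]; case: a => [q|[] b' q|[] k] //=;
  rewrite ?size_behead; lia.
Qed.

(** One instruction pushes at most one bit. Hence time bounds space, which is used both for the cost
    of the tape simulation and for the size of outputs. *)
Lemma height_steps (X : Type) (A : frag X) (c c' : fr_Q A + X) s s' t :
  steps c s c' s' t -> height s' <= height s + t.
Proof.
elim=> [c1 s1|q s1 c1 s1' t1 _ IH]; first by rewrite addn0.
by have := height_exec (fr_delta q) s1; lia.
Qed.

Lemma height_runs (X : Type) (A : frag X) x s s' t :
  runs A s x s' t -> height s' <= height s + t.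
Proof. by move=> [t' le /height_steps]; lia. Qed.

(** * Stack machines on a Turing tape *)

(* The four stacks lie on four parallel tracks of the tape, bottoms aligned on
   the cell carrying the home flag [.1]; each instruction walks to the top of
   its stack and back. *)
Notation cell := (bool * quad (option bool))%type.

Definition blank_cell : cell := (false, (None, None, None, None)).

Section Simulation.
Variable A : frag unit.

Notation sQ := (fr_Q A + unit)%type.
(* The phase is [None] when walking up, [Some true] when on the top of the stack
   to be popped, [Some false] when walking home; the outer [None] is the initial
   state, which sets the home flag. *)
Definition sim_Q : finType := option (sQ * option bool).
Notation Go := None (only parsing).
Notation Look := (Some true) (only parsing).
Notation Back := (Some false) (only parsing).

Definition sim_delta (q : sim_Q) (g : cell) : sim_Q * cell * dir :=
  match q with
  | None => (Some (inl (fr_start A), Go), (true, g.2), Stay)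
  | Some (c, Back) => if g.1 then (Some (c, Go), g, Stay) else (Some (c, Back), g, MoveL)
  | Some (inr u, ph) => (Some (inr u, ph), g, Stay)
  | Some (inl q, ph) =>
      match fr_delta q, ph with
      | Jump c, _ => (Some (c, Go), g, Stay)
      | Push i b c, _ =>
          if qget i g.2 is Some _ then (Some (inl q, Go), g, MoveR)
          else (Some (c, Back), (g.1, qset i (Some b) g.2), Stay)
      | Pop i k, Go =>
          if qget i g.2 is Some _ then (Some (inl q, Go), g, MoveR)
          else if g.1 then (Some (k None, Go), g, Stay)
          else (Some (inl q, Look), g, MoveL)
      | Pop i k, _ =>
          (Some (k (qget i g.2), Back), (g.1, qset i None g.2), Stay)
      end
  end.

Definition sim_TM : TM := {|
  tm_Q := sim_Q;
  tm_G := cell : finType;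
  tm_blank := blank_cell;
  tm_in := fun b => (false, (None, Some b, None, None));
  tm_out := fun g => qget TrA g.2;
  tm_start := None;
  tm_halt := fun q => if q is Some (inr _, Go) then true else false;
  tm_delta := sim_delta |}.

(* [tape_at p f l g r]: the tape is described by [f] and the head scans cell [p];
   blank cells may or may not be materialised in [r]. *)
Definition tape_at (p : nat) (f : nat -> cell) (l : seq cell) (g : cell) (r : seq cell) :=
  [/\ size l = p, forall j, j < p -> nth blank_cell l j = f (p.-1 - j),
      g = f p & forall j, nth blank_cell r j = f (p.+1 + j)].

Definition upd (f : nat -> cell) p w := fun j => if j == p then w else f j.

Definition at_conf (c : config sim_TM) q p f :=
  let: (q', l, g, r) := c in q' = q /\ tape_at p f l g r.

Lemma at_step c q p f q' w d :
  at_conf c q p f -> ~~ tm_halt sim_TM q -> sim_delta q (f p) = (q', w, d) ->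
  (d = MoveL -> 0 < p) ->
  at_conf (tm_step c) q' (match d with MoveL => p.-1 | MoveR => p.+1 | Stay => p end)
    (upd f p w).
Proof.
case: c => [[[q0 l] g] r] /= [-> [sl hl hg hr]] nh dq lt0p.
rewrite (negbTE nh) -hg in dq *; rewrite dq.
have updN j : j != p -> upd f p w j = f j by rewrite /upd => /negbTE ->.
have updE : upd f p w p = w by rewrite /upd eqxx.
case: d lt0p dq => lt0p dq.
- have {lt0p} := lt0p erefl; case: l sl hl => [|h l] sl hl lt0p; first by move: sl lt0p => /= <-.
  move: p sl lt0p hl hg hr updN updE => [//|p] [sl] _ hl hg hr updN updE.
  split=> //; split=> //=.
  + move=> j lt_j; rewrite updN; last lia.
    by have := hl j.+1; rewrite /= => ->; [congr f; lia | lia].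
  + by have := hl 0; rewrite /= => ->; rewrite // updN ?subn0 //; lia.
  + case=> [|j] /=; first by rewrite addn0 updE.
    by rewrite hr updN; [congr f; lia | lia].
- have hl' j : j < p.+1 -> nth blank_cell (w :: l) j = upd f p w (p - j).
    case: j => [|j] /=; first by rewrite subn0 updE.
    move=> lt_j; rewrite updN; last lia.
    by rewrite hl; [congr f; lia | lia].
  have hr' j : nth blank_cell r j = upd f p w (p.+1 + j) by rewrite updN // neq_ltn; lia.
  case: r {hr} hr' => [|h r] hr'; split=> //; split=> //=; rewrite ?sl //.
  + by have /= := hr' 0; rewrite addn0.
  + by move=> j; have := hr' j.+1; rewrite !nth_nil => ->; congr upd; lia.
  + by have /= := hr' 0; rewrite addn0.
  + by move=> j; have /= := hr' j.+1 => ->; congr upd; lia.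
- split=> //; split=> //.
  + by move=> j lt_j; rewrite hl // updN //; lia.
  + by move=> j; rewrite hr updN //; lia.
Qed.

Lemma at_move c q p f q' d :
  at_conf c q p f -> ~~ tm_halt sim_TM q -> sim_delta q (f p) = (q', f p, d) ->
  (d = MoveL -> 0 < p) ->
  at_conf (tm_step c) q' (match d with MoveL => p.-1 | MoveR => p.+1 | Stay => p end) f.
Proof.
move=> Hc nh dq /(at_step Hc nh dq).
case: (tm_step c) => [[[q1 l1] g1] r1] [-> [sl hl hg hr]].
have updE j : upd f p (f p) j = f j by rewrite /upd; case: eqP => // ->.
by split=> //; split=> // [j lt_j||j]; rewrite ?hl ?hg ?hr ?updE.
Qed.

(** The head of the list is the top of the stack, whereas cell [0] holds the bottom; hence [rev]. *)
Definition tape_of (s : store) (f : nat -> cell) :=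
  (forall j, (f j).1 = (j == 0)) /\
  (forall i j, qget i (f j).2 = onth (rev (qget i s)) j).

Lemma iter_at_back c u p f :
  at_conf c (Some (u, Back)) p f -> (forall j, (f j).1 = (j == 0)) ->
  at_conf (iter p.+1 (@tm_step sim_TM) c) (Some (u, Go)) 0 f.
Proof.
elim: p c => [|p IH] c Hc home.
  by apply: (at_move (d := Stay) Hc) => //; [case: u {Hc} | rewrite /= home; case: u {Hc}].
rewrite iterSr; apply: IH => //.
by apply: (at_move (d := MoveL) Hc) => //; [case: u {Hc} | rewrite /= home; case: u {Hc}].
Qed.

Lemma iter_at_go c q i s f :
  at_conf c (Some (inl q, Go)) 0 f -> tape_of s f ->
  match fr_delta q with Jump _ => false | Push j _ _ => track_eqb i j
                      | Pop j _ => track_eqb i j end ->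
  forall n, n <= size (qget i s) ->
  at_conf (iter n (@tm_step sim_TM) c) (Some (inl q, Go)) n f.
Proof.
move=> Hc [_ tf] di; elim=> [//|n IH] lt_n.
rewrite iterS; apply: (at_move (d := MoveR) (IH (ltnW lt_n))) => //=.
have [x tn] : exists x, qget i (f n).2 = Some x.
  rewrite tf; case E: onth => [x|]; first by exists x.
  by have := onthTE (rev (qget i s)) n; rewrite E size_rev lt_n.
by case: (fr_delta q) di => [//|j b c'|j k] /track_eqP <-; rewrite tn.
Qed.

Lemma onth_rcons (T : Type) (l : seq T) x j :
  onth (rcons l x) j = if j == size l then Some x else onth l j.
Proof.
rewrite -cats1 onth_cat; case: ltngtP => [lt|gt|->]; rewrite ?subnn //.
by rewrite [in RHS]onth_default 1?ltnW // onth_default //= subn_gt0.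
Qed.

Lemma tape_of_push s f i b (h := size (qget i s)) :
  tape_of s f ->
  tape_of (qset i (b :: qget i s) s) (upd f h ((f h).1, qset i (Some b) (f h).2)).
Proof.
move=> [home tf]; split=> [j|j n]; rewrite /upd; first by case: (j =P h) => [->|_] /=.
rewrite qget_set; case: track_eqP => [<-|ne].
  rewrite rev_cons onth_rcons size_rev -/h.
  by case: (n =P h) => // _; rewrite qget_set; case: track_eqP.
by case: (n =P h) => [->|_] //=; rewrite qget_set; case: track_eqP.
Qed.

Lemma tape_of_pop s f i b l (h := size l) :
  qget i s = b :: l -> tape_of s f ->
  tape_of (qset i l s) (upd f h ((f h).1, qset i None (f h).2)).
Proof.
move=> si [home tf]; split=> [j|j n]; rewrite /upd; first by case: (j =P h) => [->|_] /=.
rewrite qget_set; case: track_eqP => [<-|ne].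
  case: (n =P h) => [->|/eqP nh] /=; first by rewrite qget_set; case: track_eqP => // _; rewrite onth_default ?size_rev.
  by rewrite tf si rev_cons onth_rcons size_rev (negbTE nh).
by case: (n =P h) => [->|_] //=; rewrite qget_set; case: track_eqP.
Qed.

(** The walk up and the walk home each cost at most the height of the store; the constant pays for
    the write and the turns. *)
Lemma sim_instr c q s f (e := instr_exec (fr_delta q) s) :
  at_conf c (Some (inl q, Go)) 0 f -> tape_of s f ->
  exists n f', [/\ n <= (height s).*2 + 4,
    at_conf (iter n (@tm_step sim_TM) c) (Some (e.1, Go)) 0 f' & tape_of e.2 f'].
Proof.
move=> Hc Hf; have [home tf] := Hf.
have go i := @iter_at_go c q i s f Hc Hf.
have top i : qget i (f (size (qget i s))).2 = None by rewrite tf onth_default ?size_rev.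
case dq: (fr_delta q) @e => [c'|i b c'|i k] /=; rewrite dq in go.
- exists 1, f; split=> //; first by rewrite addnC.
  by apply: (at_move (d := Stay) Hc) => //=; rewrite dq.
- have le_h := size_qget i s; have eii : track_eqb i i by case: (i).
  have {go} Hg := go i eii _ (leqnn _).
  have Hw := at_step (d := Stay) Hg isT.
  rewrite /= dq top in Hw.
  have {}Hw := Hw _ _ erefl (fun e : Stay = MoveL => match e with end).
  have [homew tw] := tape_of_push i b Hf.
  have := iter_at_back Hw homew; rewrite -iterS -iterD => Hb.
  eexists; eexists; split; [ | exact: Hb | exact: tape_of_push]; lia.
- have le_h := size_qget i s; have eii : track_eqb i i by case: (i).
  have {go} Hg := go i eii _ (leqnn _).
  case si: (qget i s) => [|b l] /=.
    exists 1, f; split; first lia; last by rewrite -si qset_get.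
    apply: (at_move (d := Stay) Hc) => //=; rewrite dq.
    by rewrite tf si /= home.
  have Hl := at_move (d := MoveL) Hg isT.
  rewrite /= dq top home si /= in Hl; have {}Hl := Hl _ erefl (fun _ => isT).
  have Hw := at_step (d := Stay) Hl isT.
  have tl : qget i (f (size l)).2 = Some b by rewrite tf si rev_cons onth_rcons size_rev eqxx.
  rewrite /= dq tl in Hw.
  have {}Hw := Hw _ _ erefl (fun e : Stay = MoveL => match e with end).
  have [homew tw] := tape_of_pop si Hf.
  have := iter_at_back Hw homew; rewrite -!iterS -iterD => Hb.
  eexists; eexists; split; [ | exact: Hb | exact: tape_of_pop si Hf].
  move: le_h; rewrite si /=; lia.
Qed.

(** No store along the run is higher than [height s + t], so each of the [t] instructions obeys the
    same linear bound; this gives the quadratic slowdown. *)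
Lemma sim_steps c0 s c1 s' t :
  steps (A := A) c0 s c1 s' t ->
  forall c f, at_conf c (Some (c0, Go)) 0 f -> tape_of s f ->
  exists n f', [/\ n <= t * ((height s + t).*2 + 4),
    at_conf (iter n (@tm_step sim_TM) c) (Some (c1, Go)) 0 f' & tape_of s' f'].
Proof.
elim=> [c2 s2|q s2 c2 s2' t2 _ IH] c f Hc Hf; first by exists 0, f.
have [n1 [f1 [le1 H1 tf1]]] := sim_instr Hc Hf.
have [n2 [f2 [le2 H2 tf2]]] := IH _ _ H1 tf1.
exists (n2 + n1), f2; split; rewrite ?iterD //.
have le_h := height_exec (fr_delta q) s2.
rewrite mulSn addnC; apply: leq_add; first by apply: leq_trans le1 _; lia.
by apply: leq_trans le2 _; rewrite leq_mul2l; lia.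
Qed.

(** The first input bit lies in cell [0], so it is the bottom of stack [TrA], and the stack read
    from its top is [rev x]. For the same reason the output is recovered with [rev]. *)
Lemma sim_init x :
  exists f, at_conf (tm_step (tm_init sim_TM x)) (Some (inl (fr_start A), Go)) 0 f /\
    tape_of ([::], rev x, [::], [::]) f.
Proof.
pose f j := nth blank_cell (map (tm_in sim_TM) x) j.
have Hi : at_conf (tm_init sim_TM x) None 0 f.
  rewrite /tm_init /f; case: x {f} => [|b x]; split=> //; split=> //= j.
  by rewrite nth_nil.
exists (upd f 0 (true, (f 0).2)); split; first exact: (at_step (d := Stay) Hi).
have fE j : f j = (false, (None, onth x j, None, None)).
  rewrite /f; have [lt_j|ge_j] := ltnP j (size x); last first.
    by rewrite nth_default ?size_map // onth_default.
  by rewrite (nth_map false) //= onthE (nth_map false).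
split=> [j|i j]; rewrite /upd; first by case: (j =P 0) => //= _; rewrite fE.
case: (j =P 0) => [->|_] /=; rewrite fE.
  by case: i; rewrite //= revK.
by case: i; rewrite /= ?revK // onth0n.
Qed.

Lemma tm_decode_onth (w : seq bool) (l : seq cell) :
  (forall j, qget TrA (nth blank_cell l j).2 = onth w j) -> @tm_decode sim_TM l = w.
Proof.
elim: l w => [|g l IH] [|b w] Hw //=; first by have := Hw 0.
  by have /= -> := Hw 0.
by have /= -> := Hw 0; rewrite (IH w) // => j; have := Hw j.+1.
Qed.

Lemma sim_computes x s' t :
  runs A ([::], rev x, [::], [::]) tt s' t ->
  exists2 n, n <= t * ((size x + t).*2 + 4) + 1 &
    tm_computes_in sim_TM x (rev (qget TrA s')) n.
Proof.
move=> [t' le_t st]; have [f [Hc Hf]] := sim_init x.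
have [n [f' [le_n Hn [_ Hf']]]] := sim_steps st Hc Hf.
exists n.+1; last first.
  rewrite /tm_computes_in iterSr; move: Hn.
  case: (iter n _ _) => [[[q l] g] r] /= [-> [_ _ hg hr]]; split=> //.
  apply: (@tm_decode_onth _ (g :: r)) => j; rewrite -Hf'.
  by case: j => [|j] /=; rewrite ?hg ?hr ?add1n.
rewrite addn1 ltnS; apply: leq_trans le_n _.
by rewrite /= size_rev !add0n !addn0; apply: leq_mul; lia.
Qed.
End Simulation.

(** * Polynomial bounds *)

(** Polynomials without subtraction are monotone, and syntax makes them closed under substitution;
    both are needed to bound a composition. *)
Inductive pol := PCst of nat | PX | PAdd of pol & pol | PMul of pol & pol.

Fixpoint pev (p : pol) (n : nat) : nat :=
  match p with
  | PCst k => k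
  | PX => n
  | PAdd p q => pev p n + pev q n
  | PMul p q => pev p n * pev q n
  end.

Fixpoint psubst (p q : pol) : pol :=
  match p with
  | PCst k => PCst k
  | PX => q
  | PAdd p1 p2 => PAdd (psubst p1 q) (psubst p2 q)
  | PMul p1 p2 => PMul (psubst p1 q) (psubst p2 q)
  end.

Lemma pev_subst p q n : pev (psubst p q) n = pev p (pev q n).
Proof. by elim: p => //= p1 -> p2 ->. Qed.

Lemma pev_mono p m n : m <= n -> pev p m <= pev p n.
Proof. by move=> le_mn; elim: p => //= p1 H1 p2 H2; [apply: leq_add | apply: leq_mul]. Qed.

(** The base is at least 2 for every [n], so one extra power absorbs the factor 2 of a sum and a
    power of it exceeds any constant. *)
Lemma pev_expn p : exists d, forall n, pev p n <= n.+2 ^ d.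
Proof.
elim: p => [k||p [a Ha] q [b Hb]|p [a Ha] q [b Hb]] /=.
- exists k => n; apply: leq_trans (ltnW (ltn_expl k (isT : 1 < 2))) _.
  by case: k => // k; rewrite leq_exp2r.
- by exists 1 => n; rewrite expn1; lia.
- exists (a + b).+1 => n; rewrite expnS mulSn mulSn.
  have ge1 d : 0 < n.+2 ^ d by rewrite expn_gt0.
  have lea : pev p n <= n.+2 ^ (a + b).
    by apply: leq_trans (Ha n) _; rewrite expnD leq_pmulr.
  have leb : pev q n <= n.+2 ^ (a + b).
    by apply: leq_trans (Hb n) _; rewrite expnD leq_pmull.
  by rewrite addnA; apply: leq_trans (leq_add lea leb) (leq_addr _ _).
- by exists (a + b) => n; rewrite expnD; apply: leq_mul.
Qed.

Lemma pev_bound p : exists c, forall n, pev p n <= n ^ c + c.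
Proof.
(* For [n <= 1] the bound is at most [3 ^ d], paid by the additive constant. For [n >= 2] we have
   [n + 2 <= n ^ 2], which needs exponent [2 * d]. *)
have [d Hd] := pev_expn p; exists (3 ^ d + d.*2) => n; apply: leq_trans (Hd n) _.
have [le1|lt1] := leqP n 1.
  rewrite addnA; apply: leq_trans (leq_addr _ _); apply: leq_trans (leq_addl _ _).
  by case: d {Hd} => // d; rewrite leq_exp2r.
apply: leq_trans (leq_addr _ _).
have le_sq : n.+2 <= n ^ 2 by nia.
apply: (@leq_trans ((n ^ 2) ^ d)); first by case: d {Hd} => // d; rewrite leq_exp2r.
by rewrite -expnM leq_pexp2l; lia.
Qed.

Lemma poly_time_of_frag (f : seq bool -> seq bool) (A : frag unit) (p : pol) :
  (forall x, exists s', runs A ([::], rev x, [::], [::]) tt s' (pev p (size x)) /\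
     qget TrA s' = rev (f x)) ->
  poly_time_computable f.
Proof.
move=> HA.
pose p2 := PAdd (PMul p (PAdd (PMul (PCst 2) (PAdd PX p)) (PCst 4))) (PCst 1).
have [c Hc] := pev_bound p2.
exists (sim_TM A), c => x; have [s' [Hr Es]] := HA x.
have [n le_n Hn] := sim_computes Hr; exists n; split; last by rewrite Es revK in Hn.
by apply: leq_trans le_n (leq_trans _ (Hc _)); rewrite /= mul2n.
Qed.

(** * Polynomial-time functions on binary trees *)

Inductive tree := Leaf | Node of tree & tree.

(** Preorder code. It is self-delimiting, so a tree can be taken off a stack without knowing its
    length or what lies below it. *)
Fixpoint tcode (x : tree) : seq bool :=
  match x with
  | Leaf => [:: false]
  | Node a b => true :: tcode a ++ tcode b
  end.

Fixpoint tsz (x : tree) : nat :=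
  match x with Leaf => 1 | Node a b => (tsz a + tsz b).+1 end.

Lemma size_tcode x : size (tcode x) = tsz x.
Proof. by elim: x => //= a Ha b Hb; rewrite size_cat Ha Hb. Qed.

Lemma tsz_gt0 x : 0 < tsz x. Proof. by case: x. Qed.

Lemma runs_bind_push (Y : Type) i b (K : unit -> frag Y) s y s'' t :
  runs (K tt) (qset i (b :: qget i s) s) y s'' t ->
  runs (fbind (fpush i b) K) s y s'' t.+1.
Proof. by rewrite -add1n; apply: runs_bind; exact: runs_push. Qed.

Lemma runs_bind_pop (Y : Type) i (K : option bool -> frag Y) s y s'' t :
  runs (K (ohead (qget i s))) (qset i (behead (qget i s)) s) y s'' t ->
  runs (fbind (fpop i) K) s y s'' t.+1.
Proof. by rewrite -add1n; apply: runs_bind; exact: runs_pop. Qed.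

Definition fseq (X : Type) (A : frag unit) (B : frag X) : frag X := fbind A (fun=> B).

Lemma runs_seq (X : Type) (A : frag unit) (B : frag X) s s' x s'' t1 t2 :
  runs A s tt s' t1 -> runs B s' x s'' t2 -> runs (fseq A B) s x s'' (t1 + t2).
Proof. exact: runs_bind. Qed.

(** * Moving, dropping, swapping and copying trees on the stacks *)

Definition aux (b : bool) : track := if b then TrA else TrB.

Definition mkst (b : bool) (m x y c : seq bool) : store :=
  if b then (m, x, y, c) else (m, y, x, c).

(* TrC counts in unary the subtrees still to be read. *)
Definition fmove_body (b : bool) : frag (option unit) :=
  fbind (fpop TrC) (fun o => if o is None then fret (Some tt) else
  fbind (fpop TrM) (fun o =>
    match o with
    | Some true =>
        fseq (fpush (aux b) true) (fseq (fpush TrC true) (fseq (fpush TrC true) (fret None)))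
    | Some false => fseq (fpush (aux b) false) (fret None)
    | None => fret None
    end)).

Definition fmove (b : bool) : frag unit := fseq (fpush TrC true) (floop (fmove_body b)).

(** Stated with a continuation of cost [t], so that the induction can chain the two subtrees:
    reading [x] consumes exactly one unit of the counter [c]. *)
Lemma runs_move_body b x m z y c u s' t :
  runs (floop (fmove_body b)) (mkst b m (rev (tcode x) ++ z) y c) u s' t ->
  runs (floop (fmove_body b)) (mkst b (tcode x ++ m) z y (true :: c)) u s' (6 * tsz x + t).
Proof.
elim: x m z c t => [|x1 IH1 x2 IH2] m z c t Hr.
  apply: (@runs_leq _ _ _ _ _ (4 + t)); first by rewrite /=; lia.
  apply: runs_loop_next Hr.
  by apply: runs_bind_pop; case: b => /=;
    (apply: runs_bind_pop; apply: runs_bind_push; exact: runs_ret).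
apply: (@runs_leq _ _ _ _ _ (6 + (6 * tsz x1 + (6 * tsz x2 + t)))); first by rewrite /=; lia.
apply: (@runs_loop_next _ _ _ (mkst b (tcode x1 ++ (tcode x2 ++ m)) (true :: z) y (true :: true :: c))).
  by apply: runs_bind_pop; case: b {IH1 IH2 Hr} => /=;
    (apply: runs_bind_pop; do 3!apply: runs_bind_push; rewrite /= -catA; exact: runs_ret).
apply: IH1; apply: IH2; move: Hr => /=.
by rewrite rev_cons rev_cat cat_rcons catA.
Qed.

Lemma runs_move b x m z y :
  runs (fmove b) (mkst b (tcode x ++ m) z y [::]) tt
    (mkst b m (rev (tcode x) ++ z) y [::]) (6 * tsz x + 3).
Proof.
rewrite addnS; apply: runs_bind_push.
have -> : qset TrC [:: true & qget TrC (mkst b (tcode x ++ m) z y [::])]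
   (mkst b (tcode x ++ m) z y [::]) = mkst b (tcode x ++ m) z y [:: true] by case: b.
apply: runs_move_body; apply: runs_loop_stop.
by apply: runs_bind_pop; case: b => /=; apply: runs_ret.
Qed.

(** The common loop of flushing, dropping and copying: it pops a stack until it is empty and handles
    each bit with [K], hence acts as a [foldl]. *)
Definition funload (b : bool) (K : bool -> frag unit) : frag unit :=
  floop (fbind (fpop (aux b)) (fun o =>
    if o is Some v then fseq (K v) (fret None) else fret (Some tt))).

Definition mkst3 (b : bool) (x : seq bool) (w : seq bool * seq bool) : store :=
  mkst b w.1 x w.2 [::].

Lemma runs_unload b (K : bool -> frag unit) k G x w :
  (forall v x w, runs (K v) (mkst3 b x w) tt (mkst3 b x (G w v)) k) ->
  runs (funload b K) (mkst3 b x w) tt (mkst3 b [::] (foldl G w x)) ((k + 2) * size x + 2).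
Proof.
move=> HK; elim: x w => [|v x IH] w.
  rewrite muln0; apply: runs_loop_stop; apply: runs_bind_pop.
  by rewrite /mkst3; case: b {HK} => /=; apply: runs_ret.
apply: (@runs_leq _ _ _ _ _ ((k + 1).+1 + ((k + 2) * size x + 2))); first by rewrite /=; lia.
apply: runs_loop_next (IH (G w v)); apply: runs_bind_pop.
have -> : qget (aux b) (mkst3 b (v :: x) w) = v :: x by case: b {HK IH}.
have -> : qset (aux b) (behead (v :: x)) (mkst3 b (v :: x) w) = mkst3 b x w by case: b {HK IH}.
by apply: runs_seq (HK _ _ _) (runs_ret _ _).
Qed.

Definition fflush (b : bool) : frag unit := funload b (fpush TrM).

Lemma runs_flush b m x y :
  runs (fflush b) (mkst b m x y [::]) tt (mkst b (rev x ++ m) [::] y [::]) (3 * size x + 2).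
Proof.
have H v z w : runs (fpush TrM v) (mkst3 b z w) tt (mkst3 b z (v :: w.1, w.2)) 1.
  by case: b; apply: runs_push.
have := runs_unload x (m, y) H; rewrite /mkst3 /=.
have -> : foldl (fun w v => (v :: w.1, w.2)) (m, y) x = (rev x ++ m, y) => //.
by elim: x m => //= v x IH m; rewrite IH rev_cons cat_rcons.
Qed.

Definition fdrop : frag unit := fseq (fmove true) (funload true (fun=> fret tt)).

Lemma runs_drop x m :
  runs fdrop (tcode x ++ m, [::], [::], [::]) tt (m, [::], [::], [::]) (9 * tsz x + 5).
Proof.
apply: (@runs_leq _ _ _ _ _ (6 * tsz x + 3 + ((1 + 2) * size (rev (tcode x)) + 2))).
  by rewrite size_rev size_tcode; lia.
apply: runs_seq; first exact: (runs_move true x m [::] [::]).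
have H (v : bool) z w : runs (fret tt) (mkst3 true z w) tt (mkst3 true z w) 1 by exact: runs_ret.
have := runs_unload (rev (tcode x)) (m, [::]) H; rewrite /mkst3 /= cats0.
by have -> : foldl (fun w (_ : bool) => w) (m, [::]) (rev (tcode x)) = (m, [::]) by elim: rev.
Qed.

Definition fswap : frag unit :=
  fseq (fmove true) (fseq (fmove false) (fseq (fflush true) (fflush false))).

Lemma runs_swap x y m :
  runs fswap (tcode x ++ tcode y ++ m, [::], [::], [::]) tt
    (tcode y ++ tcode x ++ m, [::], [::], [::]) (9 * (tsz x + tsz y) + 10).
Proof.
apply: (@runs_leq _ _ _ _ _ (6 * tsz x + 3 + (6 * tsz y + 3 +
  (3 * size (rev (tcode x)) + 2 + (3 * size (rev (tcode y)) + 2))))).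
  by rewrite !size_rev !size_tcode; lia.
apply: runs_seq; first exact: (runs_move true x _ [::] [::]).
apply: runs_seq; first exact: (runs_move false y _ [::] (rev (tcode x) ++ [::])).
rewrite /mkst !cats0.
apply: runs_seq; first exact: (runs_flush true _ _ _).
have := runs_flush false (tcode x ++ m) (rev (tcode y)) [::].
by rewrite /mkst !revK.
Qed.

(** Unloading onto two stacks yields two copies. Flushing the one on [TrB] straight to the main
    stack would reverse it, so it passes through [TrA] first. *)
Definition fdup : frag unit :=
  fseq (fmove true) (fseq (funload true (fun v => fseq (fpush TrM v) (fpush TrB v)))
    (fseq (funload false (fpush TrA)) (fflush true))).

Lemma runs_dup x m :
  runs fdup (tcode x ++ m, [::], [::], [::]) tt
    (tcode x ++ tcode x ++ m, [::], [::], [::]) (16 * tsz x + 10).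
Proof.
apply: (@runs_leq _ _ _ _ _ (6 * tsz x + 3 + ((2 + 2) * size (rev (tcode x)) + 2 +
  ((1 + 2) * size (tcode x) + 2 + (3 * size (rev (tcode x)) + 2))))).
  by rewrite !size_rev !size_tcode; lia.
apply: runs_seq; first exact: (runs_move true x _ [::] [::]).
apply: (runs_seq (s' := (tcode x ++ m, [::], tcode x, [::]))).
  have H v z w : runs (fseq (fpush TrM v) (fpush TrB v)) (mkst3 true z w) tt
      (mkst3 true z (v :: w.1, v :: w.2)) 2.
    by apply: runs_bind_push; apply: runs_push.
  have := runs_unload (rev (tcode x)) (m, [::]) H; rewrite /mkst3 /= cats0.
  suff -> : foldl (fun w v => (v :: w.1, v :: w.2)) (m, [::]) (rev (tcode x)) =
    (tcode x ++ m, tcode x) by [].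
  have foldE y n z : foldl (fun w v => (v :: w.1, v :: w.2)) (n, z) y =
      (rev y ++ n, rev y ++ z) :> seq bool * seq bool.
    by elim: y n z => //= v y IH n z; rewrite IH rev_cons !cat_rcons.
  by rewrite foldE revK cats0.
apply: (runs_seq (s' := (tcode x ++ m, rev (tcode x), [::], [::]))).
  have H v z w : runs (fpush TrA v) (mkst3 false z w) tt (mkst3 false z (w.1, v :: w.2)) 1.
    exact: runs_push.
  have := runs_unload (tcode x) (tcode x ++ m, [::]) H; rewrite /mkst3 /=.
  suff -> : foldl (fun w v => (w.1, v :: w.2)) (tcode x ++ m, [::]) (tcode x) =
    (tcode x ++ m, rev (tcode x)) by [].
  rewrite -[in RHS](cats0 (rev _)); move: (tcode x ++ m) [::] => n z.
  by elim: (tcode x) z => //= v y IH z; rewrite IH rev_cons !cat_rcons.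
by have := runs_flush true (tcode x ++ m) (rev (tcode x)) [::]; rewrite /mkst revK.
Qed.

Definition mst (m : seq bool) : store := (m, [::], [::], [::]).

(* [ptf e f]: some stack program replaces a tree [e a] on top of the main stack by
   [f a], in time polynomial in the size of [e a]; nothing is required of trees
   that are not of the form [e a]. *)
Definition ptf (A : Type) (e f : A -> tree) : Prop :=
  exists (M : frag unit) (p : pol), forall a m,
    runs M (mst (tcode (e a) ++ m)) tt (mst (tcode (f a) ++ m)) (pev p (tsz (e a))).

(** * Closure properties of tree programs *)

Section Closure.
Variables (A : Type) (e : A -> tree).
Implicit Types f g : A -> tree.

Lemma ptf_size f : ptf e f -> exists p, forall a, tsz (f a) <= pev p (tsz (e a)).
Proof.
move=> [M [p HM]]; exists (PAdd PX p) => a /=.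
by have := height_runs (HM a [::]); rewrite /= !cats0 !size_tcode !addn0.
Qed.

Lemma ptf_ext f g : f =1 g -> ptf e f -> ptf e g.
Proof. by move=> fg [M [p HM]]; exists M, p => a m; rewrite -fg. Qed.

Lemma ptf_id : ptf e e.
Proof. by exists (fret tt), (PCst 1) => a m; apply: runs_ret. Qed.

(** The function [g] is the output of the first program and the input format of the second, so
    nothing has to be decoded in between. *)
Lemma ptf_comp f g : ptf e g -> ptf g f -> ptf e f.
Proof.
move=> Hg [M [p HM]]; have [q Hq] := ptf_size Hg; have [N [r HN]] := Hg.
exists (fseq N M), (PAdd r (psubst p q)) => a m /=.
apply: runs_seq (HN a m) _; rewrite pev_subst.
exact: runs_leq (pev_mono _ (Hq a)) (HM _ _).
Qed.

Fixpoint fpushes (l : seq bool) : frag unit :=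
  if l is b :: l then fseq (fpushes l) (fpush TrM b) else fret tt.

Lemma runs_pushes l m a b c :
  runs (fpushes l) (m, a, b, c) tt (l ++ m, a, b, c) (size l).+1.
Proof.
elim: l => [|v l IH] /=; first exact: runs_ret.
by rewrite -[_.+2]addn1; apply: runs_seq IH _; apply: runs_push.
Qed.

Lemma ptf_const c : ptf e (fun=> c).
Proof.
exists (fseq fdrop (fpushes (tcode c))), (PAdd (PAdd (PMul (PCst 9) PX) (PCst 5)) (PCst (tsz c).+1)).
move=> a m /=; apply: runs_seq; first exact: runs_drop.
by rewrite -size_tcode; apply: runs_pushes.
Qed.

Lemma ptf_pair f g : ptf e f -> ptf e g -> ptf e (fun a => Node (f a) (g a)).
Proof.
move=> [M [p HM]] Hg; have [q Hq] := ptf_size Hg; have [N [r HN]] := Hg.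
(* The second component is computed first, on the copy: the code of a node has its left subtree on
   top. *)
exists (fseq fdup (fseq N (fseq fswap (fseq M (fpush TrM true))))).
exists (PAdd (PAdd (PMul (PCst 16) PX) (PCst 10)) (PAdd r
  (PAdd (PAdd (PMul (PCst 9) (PAdd q PX)) (PCst 10)) (PAdd p (PCst 1))))) => a m /=.
apply: runs_seq; first exact: runs_dup.
apply: runs_seq; first exact: HN.
apply: runs_seq.
  apply: runs_leq (runs_swap _ _ _).
  by have := Hq a; lia.
apply: runs_seq; first exact: HM.
by rewrite -catA; apply: runs_push.
Qed.

Definition thd x := if x is Node a b then a else Leaf.
Definition ttl x := if x is Node a b then b else Leaf.

Lemma ptf_tl f : ptf e f -> ptf e (fun a => ttl (f a)).
Proof.
move/ptf_comp; apply.
exists (fbind (fpop TrM) (fun o => if o is Some true then fdrop else fpush TrM false)),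
  (PAdd (PMul (PCst 9) PX) (PCst 6)) => a m.
case: (f a) => [|x y]; first by apply: (@runs_leq _ _ _ _ _ 2); [ | apply: runs_bind_pop; apply: runs_push].
apply: (@runs_leq _ _ _ _ _ (9 * tsz x + 5).+1); first by rewrite /=; lia.
by apply: runs_bind_pop; rewrite /= -catA; apply: runs_drop.
Qed.

Lemma ptf_hd f : ptf e f -> ptf e (fun a => thd (f a)).
Proof.
move/ptf_comp; apply.
exists (fbind (fpop TrM) (fun o => if o is Some true then fseq fswap fdrop else fpush TrM false)),
  (PAdd (PMul (PCst 18) PX) (PCst 16)) => a m.
case: (f a) => [|x y]; first by apply: (@runs_leq _ _ _ _ _ 2); [ | apply: runs_bind_pop; apply: runs_push].
apply: (@runs_leq _ _ _ _ _ (9 * (tsz x + tsz y) + 10 + (9 * tsz y + 5)).+1).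
  by rewrite /=; lia.
apply: runs_bind_pop; rewrite /= -catA.
by apply: runs_seq; [exact: runs_swap | exact: runs_drop].
Qed.

Lemma ptf_if c f g : ptf e c -> ptf e f -> ptf e g ->
  ptf e (fun a => if c a is Leaf then f a else g a).
Proof.
move=> Hc [M [p HM]] [N [q HN]].
have [r Hr] := ptf_size Hc; have [C [pc HC]] := ptf_pair Hc ptf_id.
(* The first pop removes the root of the pair, the second reads the root of [c a]. A leaf is thereby
   consumed entirely; otherwise its two subtrees remain to be dropped. *)
exists (fseq C (fbind (fpop TrM) (fun=> fbind (fpop TrM) (fun o =>
  if o is Some true then fseq fdrop (fseq fdrop N) else M)))).
exists (PAdd pc (PAdd (PAdd p q) (PAdd (PMul (PCst 18) r) (PCst 12)))) => a m /=.
apply: runs_seq; first exact: HC.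
have lec := Hr a.
case cx: (c a) => [|x y] in lec *.
  apply: (@runs_leq _ _ _ _ _ (pev p (tsz (e a))).+2); first lia.
  by do 2!apply: runs_bind_pop; apply: HM.
apply: (@runs_leq _ _ _ _ _ (9 * tsz x + 5 + (9 * tsz y + 5 + pev q (tsz (e a)))).+2).
  by move: lec => /=; lia.
do 2!apply: runs_bind_pop; rewrite /= -!catA.
by apply: runs_seq; [exact: runs_drop | apply: runs_seq; [exact: runs_drop | exact: HN]].
Qed.

Fixpoint tlen x := if x is Node _ b then (tlen b).+1 else 0.

(** The right spine of [c a] is the loop counter. The step has to be correct only on states that
    occur before the counter runs out, hence the subtype. The bound [p] is essential: iterating a
    polynomial-time step can otherwise produce exponentially large states. *)
Lemma ptf_iter (c : A -> tree) (st : A -> nat -> tree) p :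
  ptf e c -> ptf e (st^~ 0) ->
  ptf (fun x : {x : A * nat | x.2 < tlen (c x.1)} => st (sval x).1 (sval x).2)
      (fun x => st (sval x).1 (sval x).2.+1) ->
  (forall a i, i <= tlen (c a) -> tsz (st a i) <= pev p (tsz (e a))) ->
  ptf e (fun a => st a (tlen (c a))).
Proof.
move=> Hc H0 [M [q HM]] Hp.
have [r Hr] := ptf_size Hc; have [C [pc HC]] := ptf_pair Hc H0.
pose body : frag (option unit) := fbind (fpop TrM) (fun o =>
  if o is Some true then fseq fdrop (fseq fswap (fseq M (fseq fswap (fret None))))
  else fret (Some tt)).
(* [N] bounds the counter, [P] every state, and [X] the cost of a round: one drop, two swaps and one
   call of [M]. *)
have loopE a t i m (N := tsz (c a)) (P := pev p (tsz (e a)))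
    (X := 27 * N + 18 * P + 26 + pev q P) : tsz t <= N -> tlen t + i = tlen (c a) ->
    runs (floop body) (mst (tcode t ++ tcode (st a i) ++ m)) tt
      (mst (tcode (st a (tlen (c a))) ++ m)) (tsz t * X + 2).
  elim: t i => [|x _ t IH] i leN def_i.
    apply: (@runs_leq _ _ _ _ _ 2); first by rewrite leq_addl.
    rewrite -def_i add0n.
    by apply: runs_loop_stop; apply: runs_bind_pop; apply: runs_ret.
  have lt_i : i < tlen (c a) by rewrite -def_i /=; lia.
  have P0 := Hp a _ (ltnW lt_i); have P1 := Hp a _ lt_i.
  rewrite -/P [tsz (Node x t)]/= in leN P0 P1 *.
  apply: (@runs_leq _ _ _ _ _ ((9 * tsz x + 5 + (9 * (tsz t + tsz (st a i)) + 10 + (pev q P +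
    (9 * (tsz (st a i.+1) + tsz t) + 10 + 1)))).+1 + (tsz t * X + 2))).
    rewrite [(_ + _).+1 * X]mulSn mulnDl.
    by move: (tsz x * X) (tsz t * X) => ? ?; rewrite /X; lia.
  apply: (runs_loop_next (s' := mst (tcode t ++ tcode (st a i.+1) ++ m)));
    last by apply: IH; [lia | move: def_i => /=; lia].
  apply: runs_bind_pop; rewrite /= -!catA.
  apply: runs_seq; first exact: runs_drop.
  apply: runs_seq; first exact: runs_swap.
  apply: runs_seq; last by apply: runs_seq; [exact: runs_swap | exact: runs_ret].
  exact: runs_leq (pev_mono _ P0) (HM (exist _ (a, i) lt_i) _).
exists (fseq C (fbind (fpop TrM) (fun=> floop body))).
exists (PAdd pc (PAdd (PAdd (PMul r (PAdd (PAdd (PAdd (PMul (PCst 27) r) (PMul (PCst 18) p)) (PCst 26))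
  (psubst q p))) (PCst 2)) (PCst 1))) => a m.
rewrite /= addn1 pev_subst; apply: runs_seq; first exact: HC.
apply: runs_bind_pop; rewrite /= -!catA.
apply: runs_leq (loopE a (c a) 0 m (leqnn _) (addn0 _)).
have := Hr a; set N := tsz (c a); set R := pev r _ => le_NR.
by rewrite leq_add2r; apply: leq_mul => //; lia.
Qed.
End Closure.

Lemma ptf_dom (A X : Type) (e f : A -> tree) (h : X -> A) :
  ptf e f -> ptf (fun x => e (h x)) (fun x => f (h x)).
Proof. by move=> [M [p HM]]; exists M, p => x m. Qed.

Definition tbool (b : bool) : tree := if b then Node Leaf Leaf else Leaf.

Definition tlist (l : seq tree) : tree := foldr Node Leaf l.

Lemma ptf_poly_time (f : seq bool -> seq bool) :
  ptf (fun x => tlist (map tbool x)) (fun x => tlist (map tbool (f x))) ->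
  poly_time_computable f.
Proof.
move=> Hf; have [q Hq] := ptf_size Hf; have [A [p HA]] := Hf.
(* The input stack has its last bit on top, so the list is built from its end, starting with the
   leaf [false]. A cell of the list begins with [true, true, false, false] if it holds [true] and
   with [true, false] if it holds [false]; [fout] recognises these prefixes. *)
pose fin : frag unit := fseq (fpush TrM false) (funload true (fun v =>
  fseq (fpushes (tcode (tbool v))) (fpush TrM true))).
pose fout : frag unit := floop (fbind (fpop TrM) (fun o => if o is Some true then
   fbind (fpop TrM) (fun o => if o is Some true then
     fbind (fpop TrM) (fun=> fbind (fpop TrM) (fun=> fseq (fpush TrA true) (fret None)))
     else fseq (fpush TrA false) (fret None))
  else fret (Some tt))).
have Hin x : runs fin ([::], rev x, [::], [::]) tt (mst (tcode (tlist (map tbool x)))) (7 * size x + 3).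
  rewrite addnS; apply: runs_bind_push.
  have H v z w : runs (fseq (fpushes (tcode (tbool v))) (fpush TrM true)) (mkst3 true z w) tt
      (mkst3 true z (true :: tcode (tbool v) ++ w.1, w.2)) 5.
    apply: (@runs_leq _ _ _ _ _ ((size (tcode (tbool v))).+1 + 1)); first by case: v.
    apply: (@runs_seq _ _ _ _ (mkst3 true z (tcode (tbool v) ++ w.1, w.2))); last exact: runs_push.
    exact: runs_pushes.
  have := runs_unload (rev x) ([:: false], [::]) H; rewrite size_rev /mkst3 /=.
  suff -> : foldl (fun w v => (true :: tcode (tbool v) ++ w.1, w.2)) ([:: false], [::]) (rev x) =
    (tcode (tlist (map tbool x)), [::] : seq bool) by [].
  by rewrite foldl_rev; elim: x => //= v x ->.
have Hout y z : runs fout (tcode (tlist (map tbool y)), z, [::], [::]) tt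
    ([::], rev y ++ z, [::], [::]) (6 * size y + 2).
  elim: y z => [|v y IH] z; first by apply: runs_loop_stop; apply: runs_bind_pop; apply: runs_ret.
  apply: (@runs_leq _ _ _ _ _ (6 + (6 * size y + 2))); first by rewrite /=; lia.
  rewrite rev_cons cat_rcons; apply: runs_loop_next (IH (v :: z)).
  case: v {IH}.
    by do 4!apply: runs_bind_pop; apply: runs_bind_push; exact: runs_ret.
  apply: (@runs_leq _ _ _ _ _ 4) => //.
  by do 2!apply: runs_bind_pop; apply: runs_bind_push; exact: runs_ret.
have len_tlist x : size x <= tsz (tlist (map tbool x)) <= 4 * size x + 1.
  by elim: x => [|[] x IH] //=; lia.
pose lin := PAdd (PMul (PCst 4) PX) (PCst 1).
apply: (@poly_time_of_frag _ (fseq fin (fseq A fout)) (PAdd (PAdd (PMul (PCst 7) PX) (PCst 3))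
   (PAdd (psubst p lin) (PAdd (PMul (PCst 6) (psubst q lin)) (PCst 2))))) => x.
exists ([::], rev (f x), [::], [::]); split=> //=; rewrite !pev_subst.
have /andP[_ le_lin] := len_tlist x.
apply: runs_seq (Hin x) _; apply: runs_seq.
  have := HA x [::]; rewrite !cats0.
  exact/runs_leq/pev_mono.
have := Hout (f x) [::]; rewrite cats0; apply: runs_leq.
have /andP[le_f _] := len_tlist (f x); have := Hq x.
have := pev_mono q le_lin; rewrite /=; lia.
Qed.

(** * Polynomial-time functions on encoded data *)

Structure encType := EncType { esort :> Type; enc : esort -> tree }.

Canonical bool_encType := EncType tbool.
(** Unary, so that a number can serve as the counter of a loop. *)
Canonical nat_encType := EncType (fun n => tlist (nseq n Leaf)).
Canonical prod_encType (A B : encType) := EncType (fun x : A * B => Node (enc x.1) (enc x.2)).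
Canonical seq_encType (A : encType) := EncType (fun l : seq A => tlist (map (@enc A) l)).
(** The type [T] is fixed, so this code has bounded size, and every function of a set is a finite
    case distinction. *)
Canonical set_encType (T : finType) :=
  EncType (fun A : {set T} => enc (nat_of_ord (enum_rank A))).

Definition esz (A : encType) (a : A) : nat := tsz (enc a).

Lemma esz_nat (n : nat) : esz n = n.*2.+1.
Proof. by rewrite /esz; elim: n => //= n ->; lia. Qed.

Lemma esz_pair (A B : encType) (x : A * B) :
  esz x = (esz x.1 + esz x.2).+1.
Proof. by []. Qed.

Lemma esz_cons (A : encType) (a : A) (l : seq A) : esz (a :: l) = (esz a + esz l).+1.
Proof. by []. Qed.

Lemma esz_nil (A : encType) : esz (@nil A) = 1. Proof. by []. Qed.

Lemma esz_gt0 (A : encType) (a : A) : 0 < esz a.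
Proof. exact: tsz_gt0. Qed.

Lemma esz_cat (A : encType) (s t : seq A) : (esz (s ++ t)).+1 = esz s + esz t.
Proof. by elim: s => [|a s IH] //; rewrite cat_cons !esz_cons -addnS IH; lia. Qed.

Lemma esz_rev (A : encType) (s : seq A) : esz (rev s) = esz s.
Proof.
elim: s => [|a s IH] //; rewrite rev_cons -cats1 esz_cons; apply: succn_inj.
by rewrite esz_cat IH esz_cons esz_nil; lia.
Qed.

Lemma esz_seq_bound (A : encType) (s : seq A) N B :
  size s <= N -> all (fun x => esz x <= B) s -> esz s <= N * B.+1 + 1.
Proof.
move=> le_N le_B; apply: (@leq_trans (size s * B.+1 + 1)).
  elim: s {le_N} le_B => //= a s IH /andP[le_a /IH le_s].
  by rewrite esz_cons mulSn; lia.
by rewrite leq_add2r leq_mul2r le_N orbT.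
Qed.

Lemma esz_size (A : encType) (s : seq A) : size s < esz s.
Proof. by elim: s => //= a s; rewrite esz_cons; lia. Qed.

Lemma esz_drop (A : encType) (s : seq A) k : esz (drop k s) <= esz s.
Proof. by elim: s k => [|a s IH] [|k] //=; rewrite esz_cons; have := IH k; lia. Qed.

Lemma esz_take (A : encType) (s : seq A) k : esz (take k s) <= esz s.
Proof. by elim: s k => [|a s IH] [|k] //=; rewrite !esz_cons; have := IH k; lia. Qed.

Definition pt (A B : encType) (f : A -> B) : Prop :=
  ptf (@enc A) (fun a => enc (f a)).

Lemma tlen_nat (n : nat) : tlen (enc n) = n.
Proof. by elim: n => //= n ->. Qed.

Lemma tlen_seq (A : encType) (s : seq A) : tlen (enc s) = size s.
Proof. by elim: s => //= a s ->. Qed.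

(** * Closure rules for functions between encoded types *)

Section Rules.
Variables (A B C : encType).

Lemma pt_size (f : A -> B) : pt f -> exists p, forall a, esz (f a) <= pev p (esz a).
Proof. exact: ptf_size. Qed.

Lemma pt_ext (f g : A -> B) : f =1 g -> pt f -> pt g.
Proof. by move=> fg; apply: ptf_ext => a; rewrite fg. Qed.

Lemma pt_id : pt (fun a : A => a).
Proof. exact: ptf_id. Qed.

Lemma pt_cst (b : B) : pt (fun _ : A => b).
Proof. exact: ptf_const. Qed.

Lemma pt_comp (f : B -> C) (g : A -> B) : pt f -> pt g -> pt (fun a => f (g a)).
Proof. by move=> Hf Hg; apply: ptf_comp Hg (ptf_dom g Hf). Qed.

Lemma pt_pair (f : A -> B) (g : A -> C) : pt f -> pt g -> pt (fun a => (f a, g a)).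
Proof. exact: ptf_pair. Qed.

Lemma pt_fst (f : A -> B * C) : pt f -> pt (fun a => (f a).1).
Proof. exact: ptf_hd. Qed.

Lemma pt_snd (f : A -> B * C) : pt f -> pt (fun a => (f a).2).
Proof. exact: ptf_tl. Qed.

Lemma pt_if (c : A -> bool) (f g : A -> B) :
  pt c -> pt f -> pt g -> pt (fun a => if c a then f a else g a).
Proof.
by move=> Hc Hf Hg; apply: ptf_ext (ptf_if Hc Hg Hf) => a; case: (c a).
Qed.

Lemma pt_eq0 (f : A -> nat) : pt f -> pt (fun a => f a == 0).
Proof.
move=> Hf; apply: ptf_ext (ptf_if Hf (ptf_const _ (tbool true)) (ptf_const _ (tbool false))) => a.
by case: (f a).
Qed.

Lemma pt_cons (f : A -> B) (g : A -> seq B) : pt f -> pt g -> pt (fun a => f a :: g a).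
Proof. exact: ptf_pair. Qed.

Lemma pt_head (d : A -> B) (f : A -> seq B) : pt d -> pt f -> pt (fun a => head (d a) (f a)).
Proof.
by move=> Hd Hf; apply: ptf_ext (ptf_if Hf Hd (ptf_hd Hf)) => a; case: (f a).
Qed.

Lemma pt_behead (f : A -> seq B) : pt f -> pt (fun a => behead (f a)).
Proof. by move=> Hf; apply: ptf_ext (ptf_tl Hf) => a; case: (f a). Qed.

Lemma pt_succ (f : A -> nat) : pt f -> pt (fun a => (f a).+1).
Proof. by move=> Hf; apply: ptf_pair Hf; apply: ptf_const. Qed.

Lemma pt_pred (f : A -> nat) : pt f -> pt (fun a => (f a).-1).
Proof. by move=> Hf; apply: ptf_ext (ptf_tl Hf) => a; case: (f a). Qed.

End Rules.

Section Iteration.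
Variables (A B C : encType).

(** The loop state is the triple of the argument, the unread part of the list and the accumulator.
    The last hypothesis bounds every partial fold, as [ptf_iter] demands. *)
Lemma pt_foldl (l : A -> seq B) (f : A -> C -> B -> C) (g : A -> C) p :
  pt l -> pt (fun x : A * (C * B) => f x.1 x.2.1 x.2.2) -> pt g ->
  (forall a k, esz (foldl (f a) (g a) (take k (l a))) <= pev p (esz a)) ->
  pt (fun a => foldl (f a) (g a) (l a)).
Proof.
move=> Hl Hf Hg Hp; have [r Hr] := pt_size Hl.
pose acc a i := foldl (f a) (g a) (take i (l a)).
pose (st := fun a i => Node (enc a) (Node (enc (drop i (l a))) (enc (acc a i)))).
apply: (ptf_ext (f := fun a => ttl (ttl (st a (tlen (enc (l a))))))) => [a|].
  by rewrite /st /acc tlen_seq take_size.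
apply: ptf_tl; apply: ptf_tl.
apply: (ptf_iter (p := PAdd (PAdd PX (PAdd r p)) (PCst 2))) => //.
- apply: ptf_ext (ptf_pair (ptf_id _) (ptf_pair Hl Hg)) => a.
  by rewrite /st /acc drop0 take0.
- pose (X := {x : A * nat | x.2 < tlen (enc (l x.1))}); set e := (X in ptf X).
  have stE (x : X) : exists2 b, e x = Node (enc (sval x).1) (Node (Node (enc b)
        (enc (drop (sval x).2.+1 (l (sval x).1)))) (enc (acc (sval x).1 (sval x).2))) &
      st (sval x).1 (sval x).2.+1 =
      Node (enc (sval x).1) (Node (enc (drop (sval x).2.+1 (l (sval x).1)))
        (enc (f (sval x).1 (acc (sval x).1 (sval x).2) b))).
    case: x => [[a i] /= lt_i']; have lt_i := lt_i'; rewrite tlen_seq in lt_i.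
    (* [B] may be empty in general, so the default element for [nth] is taken from the list
       itself. *)
    have [b0 _] : exists b : B, True by case: (l a) lt_i => // b _ _; exists b.
    exists (nth b0 (l a) i); rewrite /e /st /=; first by rewrite (drop_nth b0).
    by rewrite /acc (take_nth b0) // foldl_rcons.
  have e1 := ptf_hd (ptf_id e); have e2 := ptf_tl (ptf_id e).
  have el := ptf_hd e2; have ea := ptf_tl e2.
  have Hpair := ptf_pair e1 (ptf_pair ea (ptf_hd el)).
  have Hstep : ptf (fun x => Node (thd (e x)) (Node (ttl (ttl (e x))) (thd (thd (ttl (e x))))))
      (fun x => ttl (ttl (st (sval x).1 (sval x).2.+1))).
    have [M [q HM]] := Hf; exists M, q => x m; have [b -> ->] := stE x.
    exact: (HM ((sval x).1, (acc (sval x).1 (sval x).2, b)) m).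
  apply: ptf_ext (ptf_pair e1 (ptf_pair (ptf_tl el) (ptf_comp Hpair Hstep))) => x.
  by have [b -> ->] := stE x.
- move=> a i _; change ((esz a + (esz (drop i (l a)) + esz (acc a i)).+1).+1 <=
    esz a + (pev r (esz a) + pev p (esz a)) + 2).
  by have := Hp a i; have := Hr a; have := esz_drop (l a) i; rewrite -/(acc a i); lia.
Qed.

Lemma pt_iter (n : A -> nat) (f : A -> C -> C) (g : A -> C) p :
  pt n -> pt (fun x : A * C => f x.1 x.2) -> pt g ->
  (forall a k, k <= n a -> esz (iter k (f a) (g a)) <= pev p (esz a)) ->
  pt (fun a => iter (n a) (f a) (g a)).
Proof.
move=> Hn Hf Hg Hp.
pose (st := fun a i => Node (enc a) (enc (iter i (f a) (g a)))).
apply: (ptf_ext (f := fun a => ttl (st a (tlen (enc (n a)))))) => [a|].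
  by rewrite /st /= tlen_nat.
apply: ptf_tl; apply: (ptf_iter (p := PAdd (PAdd PX p) (PCst 1))) => //.
- exact: ptf_pair (ptf_id _) Hg.
- set e := (X in ptf X).
  have Hstep : ptf e (fun x => enc (f (sval x).1 (iter (sval x).2 (f (sval x).1) (g (sval x).1)))).
    have [M [q HM]] := Hf; exists M, q => x m.
    exact: (HM ((sval x).1, iter (sval x).2 (f (sval x).1) (g (sval x).1)) m).
  exact: ptf_pair (ptf_hd (ptf_id e)) Hstep.
- move=> a i; rewrite tlen_nat => /(Hp a) Hi.
  by change ((esz a + esz (iter i (f a) (g a))).+1 <= esz a + pev p (esz a) + 1); lia.
Qed.
End Iteration.

Lemma pt_poly_time (f : seq bool -> seq bool) : pt f -> poly_time_computable f.
Proof. exact: ptf_poly_time. Qed.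

Section Arith.
Variables (A : encType).
Implicit Types (f g : A -> nat) (b c : A -> bool).

Lemma pt_not b : pt b -> pt (fun a => ~~ b a).
Proof.
by move=> Hb; apply: pt_ext (pt_if Hb (pt_cst _ false) (pt_cst _ true)) => a; case: (b a).
Qed.

Lemma pt_and b c : pt b -> pt c -> pt (fun a => b a && c a).
Proof. by move=> Hb Hc; apply: pt_ext (pt_if Hb Hc (pt_cst _ false)). Qed.

Lemma pt_or b c : pt b -> pt c -> pt (fun a => b a || c a).
Proof. by move=> Hb Hc; apply: pt_ext (pt_if Hb (pt_cst _ true) Hc). Qed.

Lemma pt_add f g : pt f -> pt g -> pt (fun a => f a + g a).
Proof.
move=> Hf Hg; have [p Hp] := pt_size Hf; have [q Hq] := pt_size Hg.
apply: (pt_ext (f := fun a => iter (f a) succn (g a))).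
  by move=> a; rewrite iter_succn addnC.
apply: (pt_iter (f := fun=> succn) (p := PAdd p q)) => //.
  by apply: pt_succ; apply: pt_snd; apply: pt_id.
by move=> a k; have := Hp a; have := Hq a; rewrite iter_succn !esz_nat /=; lia.
Qed.

Lemma pt_sub f g : pt f -> pt g -> pt (fun a => f a - g a).
Proof.
move=> Hf Hg; have [p Hp] := pt_size Hf.
have iter_predn k n : iter k predn n = n - k by elim: k => [|k /= ->]; rewrite ?subn0 ?subnS.
apply: (pt_ext (f := fun a => iter (g a) predn (f a))) => //.
apply: (pt_iter (f := fun=> predn) (p := p)) => //.
  by apply: pt_pred; apply: pt_snd; apply: pt_id.
by move=> a k; have := Hp a; rewrite iter_predn !esz_nat /=; lia.
Qed.

Lemma pt_leq f g : pt f -> pt g -> pt (fun a => f a <= g a).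
Proof. by move=> Hf Hg; apply: pt_eq0 (pt_sub Hf Hg). Qed.

Lemma pt_eqn f g : pt f -> pt g -> pt (fun a => f a == g a).
Proof.
move=> Hf Hg; apply: pt_ext (pt_and (pt_leq Hf Hg) (pt_leq Hg Hf)) => a.
by rewrite -eqn_leq.
Qed.

Lemma pt_minn f g : pt f -> pt g -> pt (fun a => minn (f a) (g a)).
Proof.
by move=> Hf Hg; apply: pt_ext (pt_if (pt_leq Hf Hg) Hf Hg) => a; case: leqP; lia.
Qed.
End Arith.

Lemma pt_mul (A : encType) (f g : A -> nat) : pt f -> pt g -> pt (fun a => f a * g a).
Proof.
move=> Hf Hg; have [p Hp] := pt_size Hf; have [q Hq] := pt_size Hg.
have iterE k m : iter k (addn m) 0 = k * m by elim: k => //= k ->; rewrite mulSn.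
apply: (pt_ext (f := fun a => iter (f a) (addn (g a)) 0)) => //.
apply: (pt_iter (f := fun a => addn (g a)) (p := PAdd (PMul p q) (PCst 1))) => //.
- by apply: pt_add; [apply: pt_comp Hg _; apply: pt_fst (pt_id _) | apply: pt_snd (pt_id _)].
- exact: pt_cst.
- move=> a k le_k; have := Hp a; have := Hq a; rewrite iterE !esz_nat /= => lq lp.
  by rewrite addn1 ltnS; apply: leq_trans (leq_mul lp lq); nia.
Qed.

Section Seqs.
Variables (A B C : encType).

Lemma pt_rev (f : A -> seq B) : pt f -> pt (fun a => rev (f a)).
Proof.
move=> Hf; have [p Hp] := pt_size Hf.
have foldE (s : seq B) : foldl (fun s b => b :: s) [::] s = rev s.
  by elim/last_ind: s => // s x IH; rewrite foldl_rcons rev_rcons IH.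
apply: (pt_ext (f := fun a => foldl (fun s b => b :: s) [::] (f a))) => [a|]; first exact: foldE.
apply: (pt_foldl (f := fun _ s b => b :: s) (g := fun=> [::]) (p := p)) => //.
- by apply: pt_cons; [do 2!apply: pt_snd | apply: pt_fst; apply: pt_snd]; apply: pt_id.
- exact: pt_cst.
- by move=> a k; rewrite foldE esz_rev; apply: leq_trans (esz_take _ _) (Hp a).
Qed.

Lemma pt_cat (f g : A -> seq B) : pt f -> pt g -> pt (fun a => f a ++ g a).
Proof.
move=> Hf Hg; have [p Hp] := pt_size Hf; have [q Hq] := pt_size Hg.
have foldE (s t : seq B) : foldl (fun s b => b :: s) t s = rev s ++ t.
  by elim/last_ind: s => // s x IH; rewrite foldl_rcons rev_rcons IH.
apply: (pt_ext (f := fun a => foldl (fun s b => b :: s) (g a) (rev (f a)))) => [a|].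
  by rewrite foldE revK.
apply: (pt_foldl (f := fun _ s b => b :: s) (p := PAdd p q)) => //; first exact: pt_rev.
- by apply: pt_cons; [do 2!apply: pt_snd | apply: pt_fst; apply: pt_snd]; apply: pt_id.
- move=> a k; have := esz_cat (rev (take k (rev (f a)))) (g a); rewrite foldE esz_rev.
  have := esz_take (rev (f a)) k; rewrite esz_rev /=; have := Hp a; have := Hq a; lia.
Qed.

Lemma pt_sizes (f : A -> seq B) : pt f -> pt (fun a => size (f a)).
Proof.
move=> Hf; have [p Hp] := pt_size Hf.
have foldE (s : seq B) : foldl (fun n _ => n.+1) 0 s = size s.
  by elim/last_ind: s => // s x IH; rewrite foldl_rcons size_rcons IH.
apply: (pt_ext (f := fun a => foldl (fun n _ => n.+1) 0 (f a))) => [a|]; first exact: foldE.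
apply: (pt_foldl (f := fun _ n _ => n.+1) (g := fun=> 0) (p := PMul (PCst 2) p)) => //.
- by apply: pt_succ; apply: pt_fst; apply: pt_snd; apply: pt_id.
- exact: pt_cst.
- move=> a k; rewrite foldE esz_nat /=; have := esz_size (f a); have := Hp a.
  by rewrite size_take_min; lia.
Qed.

Lemma pt_drop (n : A -> nat) (f : A -> seq B) : pt n -> pt f -> pt (fun a => drop (n a) (f a)).
Proof.
move=> Hn Hf; have [p Hp] := pt_size Hf.
have iterE k (s : seq B) : iter k behead s = drop k s.
  by elim: k s => [|k IH] s; rewrite ?drop0 // iterSr IH; case: s.
apply: (pt_ext (f := fun a => iter (n a) behead (f a))) => // .
apply: (pt_iter (f := fun=> behead) (p := p)) => //.
  by apply: pt_behead; apply: pt_snd; apply: pt_id.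
by move=> a k _; rewrite iterE; apply: leq_trans (esz_drop _ _) (Hp a).
Qed.

Lemma pt_nth (d : A -> B) (n : A -> nat) (f : A -> seq B) :
  pt d -> pt n -> pt f -> pt (fun a => nth (d a) (f a) (n a)).
Proof.
move=> Hd Hn Hf; apply: pt_ext (pt_head Hd (pt_drop Hn Hf)) => a.
by rewrite -nth0 nth_drop addn0.
Qed.

Lemma pt_nseq (n : A -> nat) (f : A -> B) : pt n -> pt f -> pt (fun a => nseq (n a) (f a)).
Proof.
move=> Hn Hf; have [p Hp] := pt_size Hn; have [q Hq] := pt_size Hf.
apply: (pt_ext (f := fun a => iter (n a) (cons (f a)) [::])) => //.
apply: (pt_iter (f := fun a => cons (f a)) (p := PAdd (PMul p (PAdd q (PCst 1))) (PCst 1))) => //.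
- by apply: pt_cons; [apply: pt_comp Hf _; apply: pt_fst (pt_id _) | apply: pt_snd (pt_id _)].
- exact: pt_cst.
- move=> a k le_k /=; apply: (@leq_trans (k * (esz (f a) + 1) + 1)).
    by elim: {le_k} k => //= k IH; rewrite esz_cons mulSn; lia.
  rewrite leq_add2r; apply: leq_mul; last by rewrite leq_add2r.
  by have := Hp a; rewrite esz_nat; lia.
Qed.
End Seqs.

Lemma pt_map (A B C : encType)
  (f : A -> B -> C) (l : A -> seq B) :
  pt (fun x : A * B => f x.1 x.2) -> pt l -> pt (fun a => [seq f a b | b <- l a]).
Proof.
move=> Hf Hl; have [p Hp] := pt_size Hl; have [q Hq] := pt_size Hf.
have foldE a (s : seq B) : foldl (fun s b => f a b :: s) [::] s = rev [seq f a b | b <- s].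
  by elim/last_ind: s => // s x IH; rewrite foldl_rcons map_rcons rev_rcons IH.
apply: (pt_ext (f := fun a => rev (foldl (fun s b => f a b :: s) [::] (l a)))) => [a|].
  by rewrite foldE revK.
apply: pt_rev; apply: (pt_foldl (f := fun a s b => f a b :: s) (g := fun=> [::])
  (p := PAdd (PMul p (PAdd (psubst q (PAdd (PAdd PX p) (PCst 1))) (PCst 1))) (PCst 1))) => //.
- apply: pt_cons; last by apply: pt_fst; apply: pt_snd; apply: pt_id.
  apply: (pt_comp (f := fun x : A * B => f x.1 x.2) (g := fun x : A * (seq C * B) => (x.1, x.2.2))) => //.
  by apply: pt_pair; [apply: pt_fst (pt_id _) | do 2!apply: pt_snd; apply: pt_id].
- exact: pt_cst.
- move=> a k; rewrite foldE esz_rev /= pev_subst /=.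
  rewrite [pev q _ + 1]addn1; apply: esz_seq_bound.
    by have := esz_size (l a); have := Hp a; rewrite size_map size_take_min; lia.
  rewrite all_map; have := leq_trans (esz_take (l a) k) (Hp a); move: (pev p _) => P.
  elim: (take k (l a)) => //= b s IH; rewrite esz_cons => le_P; rewrite IH ?andbT; last lia.
  by apply: leq_trans (Hq (a, b)) (pev_mono _ _); rewrite esz_pair /=; lia.
Qed.

Lemma pt_flatten (A B : encType) (f : A -> seq (seq B)) : pt f -> pt (fun a => flatten (f a)).
Proof.
move=> Hf; have [p Hp] := pt_size Hf.
have foldE (s : seq (seq B)) : foldl cat [::] s = flatten s.
  by elim/last_ind: s => // s x IH; rewrite foldl_rcons flatten_rcons IH.
apply: (pt_ext (f := fun a => foldl cat [::] (f a))) => [a|]; first exact: foldE.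
apply: (pt_foldl (f := fun=> cat) (g := fun=> [::]) (p := p)) => //.
- by apply: pt_cat; [apply: pt_fst; apply: pt_snd | do 2!apply: pt_snd]; apply: pt_id.
- exact: pt_cst.
- move=> a k; rewrite foldE; apply: leq_trans (leq_trans (esz_take (f a) k) (Hp a)).
  elim: (take k (f a)) => //= x s IH; rewrite esz_cons.
  by have := esz_cat x (flatten s); lia.
Qed.

Lemma pt_has (A B : encType) (P : A -> B -> bool) (l : A -> seq B) :
  pt (fun x : A * B => P x.1 x.2) -> pt l -> pt (fun a => has (P a) (l a)).
Proof.
move=> HP Hl.
have foldE a (s : seq B) : foldl (fun c b => c || P a b) false s = has (P a) s.
  by elim/last_ind: s => // s x IH; rewrite foldl_rcons has_rcons IH orbC.
apply: (pt_ext (f := fun a => foldl (fun c b => c || P a b) false (l a))) => [a|]; first exact: foldE.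
apply: (pt_foldl (f := fun a c b => c || P a b) (g := fun=> false) (p := PCst 3)) => //.
- apply: pt_or; first by apply: pt_fst; apply: pt_snd; apply: pt_id.
  apply: (pt_comp (f := fun x : A * B => P x.1 x.2) (g := fun x : A * (bool * B) => (x.1, x.2.2))) => //.
  by apply: pt_pair; [apply: pt_fst (pt_id _) | do 2!apply: pt_snd; apply: pt_id].
- exact: pt_cst.
- by move=> a k; case: (foldl _ _ _).
Qed.

Lemma pt_iota (A : encType) (n : A -> nat) : pt n -> pt (fun a => iota 0 (n a)).
Proof.
move=> Hn; have [p Hp] := pt_size Hn.
have iterE k : iter k (fun s => size s :: s) [::] = rev (iota 0 k).
  by elim: k => // k IH; rewrite iterS IH -addn1 iotaD rev_cat size_rev size_iota.
apply: (pt_ext (f := fun a => rev (iter (n a) (fun s => size s :: s) [::]))) => [a|].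
  by rewrite iterE revK.
apply: pt_rev; apply: (pt_iter (f := fun _ s => size s :: s) (g := fun=> [::])
  (p := PAdd (PMul p (PAdd p (PCst 1))) (PCst 1))) => //.
- by apply: pt_cons; [apply: pt_sizes|]; apply: pt_snd; apply: pt_id.
- exact: pt_cst.
- move=> a k le_k; rewrite iterE esz_rev /= [pev p _ + 1]addn1; have := Hp a; rewrite esz_nat => le_p.
  apply: esz_seq_bound; first by rewrite size_iota; lia.
  by apply/allP => x; rewrite mem_iota esz_nat; lia.
Qed.

(** No uniformity in [i] is assumed: each [f i] has its own program, and nested zero tests select
    one of the finitely many that differ. *)
Lemma pt_natcase (A B : encType) N (f : nat -> A -> B) (n : A -> nat) :
  (forall i, pt (f i)) -> (forall i, N <= i -> f i =1 f N) -> pt n -> pt (fun a => f (n a) a).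
Proof.
move=> Hf HN Hn; elim: N f n Hf HN Hn => [|N IH] f n Hf HN Hn.
  by apply: pt_ext (Hf 0) => a; rewrite HN.
have H1 : pt (fun a => f (n a).-1.+1 a).
  by apply: (IH (fun i => f i.+1)) (pt_pred Hn) => // i le_i; apply: HN.
apply: pt_ext (pt_if (pt_eq0 Hn) (Hf 0) H1) => a.
by case: (n a).
Qed.

Lemma pt_setcase (T : finType) (A B : encType) (f : {set T} -> A -> B) (g : A -> {set T}) :
  (forall X, pt (f X)) -> pt g -> pt (fun a => f (g a) a).
Proof.
move=> Hf Hg.
pose F i := f (nth set0 (enum {set T}) i).
have [M [p HM]] : pt (fun x : nat * A => F x.1 x.2).
  apply: (@pt_natcase _ _ #|{set T}| (fun i (x : nat * A) => F i x.2) fst).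
  - by move=> i; apply: pt_comp (Hf _) _; apply: pt_snd (pt_id _).
  - by move=> i le_i x; rewrite /F !nth_default -?cardE.
  - exact: pt_fst (pt_id _).
have H1 : ptf (fun a => enc (nat_of_ord (enum_rank (g a)), a)) (fun a => enc (f (g a) a)).
  exists M, p => a m; have := HM (nat_of_ord (enum_rank (g a)), a) m.
  by rewrite /F /= -enum_val_nth enum_rankK.
apply: ptf_comp H1; exact: ptf_pair Hg (ptf_id _).
Qed.

(** The list [r] belongs to the program and not to the input, so its items need no encoding. *)
Lemma pt_flatten_static (A B : encType) (I : Type) (r : seq I) (f : I -> A -> seq B) :
  (forall i, pt (f i)) -> pt (fun a => flatten [seq f i a | i <- r]).
Proof.
by move=> Hf; elim: r => [|i r IH] /=; [exact: pt_cst | exact: pt_cat].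
Qed.

Ltac pt_step :=
  lazymatch goal with
  | |- pt (fun _ => ?b) => apply: pt_cst
  | |- pt (fun a => a) => exact: pt_id
  | |- pt id => exact: pt_id
  | |- pt (@fst _ _) => exact: pt_fst (pt_id _)
  | |- pt (@snd _ _) => exact: pt_snd (pt_id _)
  | |- pt (fun a => fst (@?f a)) => apply: (pt_fst (f := f))
  | |- pt (fun a => snd (@?f a)) => apply: (pt_snd (f := f))
  | |- pt (fun a => pair (@?f a) (@?g a)) => apply: (pt_pair (f := f) (g := g))
  | |- pt (fun a => cons (@?f a) (@?g a)) => apply: (pt_cons (f := f) (g := g))
  | |- pt (fun a => if _ then _ else _) => apply: pt_if
  | |- pt (fun a => cat (@?f a) (@?g a)) => apply: (pt_cat (f := f) (g := g))
  | |- pt (fun a => S (@?f a)) => apply: (pt_succ (f := f))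
  | |- pt (fun a => addn (@?f a) (@?g a)) => apply: (pt_add (f := f) (g := g))
  | |- pt (fun a => muln (@?f a) (@?g a)) => apply: (pt_mul (f := f) (g := g))
  | |- pt (fun a => minn (@?f a) (@?g a)) => apply: (pt_minn (f := f) (g := g))
  | |- pt (fun a => eq_op (@?f a) (@?g a)) => apply: (pt_eqn (f := f) (g := g))
  | |- pt (fun a => andb (@?f a) (@?g a)) => apply: (pt_and (b := f) (c := g))
  | |- pt (fun a => negb (@?f a)) => apply: (pt_not (b := f))
  | |- pt (fun a => nseq (@?f a) (@?g a)) => apply: (pt_nseq (n := f) (f := g))
  | |- pt (fun a => rev (@?f a)) => apply: (pt_rev (f := f))
  | |- pt (fun a => flatten (@?f a)) => apply: (pt_flatten (f := f))
  | |- pt (fun a => iota 0 (@?f a)) => apply: (pt_iota (n := f))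
  | |- pt (fun a => size (@?f a)) => apply: (pt_sizes (f := f))
  | |- pt (fun a => behead (@?f a)) => apply: (pt_behead (f := f))
  | |- pt (fun a => nth (@?d a) (@?f a) (@?n a)) => apply: (pt_nth (d := d) (n := n) (f := f))
  | |- pt (fun a => map (@?f a) (@?l a)) => apply: (pt_map (f := f) (l := l))
  | |- pt (fun a => has (@?f a) (@?l a)) => apply: (pt_has (P := f) (l := l))
  | |- pt _ => assumption
  end; cbv beta.
Ltac pt_tac := repeat pt_step.

(** * Parsing and printing *)

(* Parser state: mode, number of variables or vertices, bits of the current number,
   numbers of the current item, items.  Modes: 0 unary header; 1 outer list;
   2, 3 first number of an item (before a flag, before a bit); 4, 5 later numbers;
   6 inner list; 7 done. *)
Notation pstate := (nat * (nat * (seq bool * (seq (seq bool) * seq (seq (seq bool))))))%type.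

Definition pstep (pcsp : bool) (st : pstate) (b : bool) : pstate :=
  let: (md, (n, (cur, (item, out)))) := st in
  if md == 0 then (if b then 0 else 1, (if b then n.+1 else n, (cur, (item, out))))
  else if md == 1 then (if b then 2 else 7, (n, (cur, (item, out))))
  else if md == 2 then
    if b then (3, (n, (cur, (item, out))))
    else (if pcsp then 6 else 4, (n, ([::], (item ++ [:: cur], out))))
  else if md == 3 then (2, (n, (cur ++ [:: b], (item, out))))
  else if md == 4 then
    if b then (5, (n, (cur, (item, out))))
    else if pcsp then (6, (n, ([::], (item ++ [:: cur], out))))
    else (1, (n, ([::], ([::], out ++ [:: item ++ [:: cur]]))))
  else if md == 5 then (4, (n, (cur ++ [:: b], (item, out))))
  else if md == 6 then
    if b then (4, (n, (cur, (item, out))))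
    else (1, (n, (cur, ([::], out ++ [:: item]))))
  else st.

Definition parse (pcsp : bool) (x : seq bool) : nat * seq (seq (seq bool)) :=
  let st := foldl (pstep pcsp) (0, (0, ([::], ([::], [::])))) x in (st.2.1, st.2.2.2.2).

Lemma pt_parse pcsp : pt (parse pcsp).
Proof.
have Hf : pt (foldl (pstep pcsp) (0, (0, ([::], ([::], [::]))))).
  apply: (pt_foldl (l := id) (f := fun=> pstep pcsp) (g := fun=> (0, (0, ([::], ([::], [::])))))
    (p := PAdd (PMul (PCst 6) PX) (PCst 30))); first exact: pt_id.
  - pose F (x : seq bool * (pstate * bool)) :=
      let md := x.2.1.1 in let n := x.2.1.2.1 in let cur := x.2.1.2.2.1 in
      let item := x.2.1.2.2.2.1 in let out := x.2.1.2.2.2.2 in let b := x.2.2 in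
      pstep pcsp (md, (n, (cur, (item, out)))) b.
    apply: (pt_ext (f := F)) => [[s [[md [n [cur [item out]]]] b]] //|].
    by rewrite /F /pstep; case: pcsp {F}; pt_tac.
  - exact: pt_cst.
  (* A potential that grows by at most 5 per input bit; the unary count is doubled because its code
     has size [2 * n + 1]. *)
  - pose W (st : pstate) := st.2.1.*2 + esz st.2.2.1 + esz st.2.2.2.1 + esz st.2.2.2.2.
    have cat1 (B : encType) (s : seq B) b : esz (s ++ [:: b]) = esz s + esz b + 1.
      by have := esz_cat s [:: b]; rewrite esz_cons esz_nil; lia.
    have Wstep st b : st.1 <= 7 -> W (pstep pcsp st b) <= W st + 5 /\ (pstep pcsp st b).1 <= 7.
      case: st => [md [n [cur [item out]]]]; rewrite /W /=.
      have := esz_gt0 cur; have := esz_gt0 item.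
      have : esz b <= 3 by case: b.
      do 7!(case: md => [|md] /=;
        [by case: b; case: pcsp; rewrite /= ?cat1 ?esz_nil => *; split=> //; lia|]).
      by move=> *; split=> //; lia.
    have Wfold s : W (foldl (pstep pcsp) (0, (0, ([::], ([::], [::])))) s) <= 5 * size s + 3 /\
        (foldl (pstep pcsp) (0, (0, ([::], ([::], [::])))) s).1 <= 7.
      elim/last_ind: s => // s b [IH1 IH2]; rewrite foldl_rcons size_rcons.
      by have [? ?] := Wstep _ b IH2; split=> //; lia.
    move=> x k; have [] := Wfold (take k x); case: (foldl _ _ _) => md [n [cur [item out]]].
    rewrite /W /= !esz_pair /= !esz_nat; have := esz_size x; rewrite size_take_min /=; lia.
by rewrite /parse; pt_tac.
Qed.

Lemma foldl_pstep_nat pcsp md n cur item out k :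
  md \in [:: 2; 4] ->
  foldl (pstep pcsp) (md, (n, (cur, (item, out)))) (enc_nat k) =
  pstep pcsp (md, (n, (cur ++ nat_bits k, (item, out)))) false.
Proof.
rewrite /enc_nat foldl_cat !inE => /orP[]/eqP->; rewrite /=.
  by elim: (nat_bits k) cur => [|b s IH] cur /=; rewrite ?cats0 // IH -catA.
by elim: (nat_bits k) cur => [|b s IH] cur /=; rewrite ?cats0 // IH -catA.
Qed.

Lemma foldl_pstep_unary pcsp n :
  foldl (pstep pcsp) (0, (0, ([::], ([::], [::])))) (enc_unary n) = (1, (n, ([::], ([::], [::])))).
Proof.
rewrite /enc_unary foldl_cat.
suff -> m : foldl (pstep pcsp) (0, (m, ([::], ([::], [::])))) (nseq n true) =
   (0, (m + n, ([::], ([::], [::])))) by [].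
by elim: n m => [|n IH] m /=; rewrite ?addn0 // IH addSnnS.
Qed.

Lemma foldl_pstep_list pcsp (T : Type) (e : T -> seq bool) (g : T -> seq (seq bool)) :
  (forall x n out, foldl (pstep pcsp) (2, (n, ([::], ([::], out)))) (e x) =
     (1, (n, ([::], ([::], out ++ [:: g x]))))) ->
  forall s n, foldl (pstep pcsp) (1, (n, ([::], ([::], [::])))) (enc_list e s) =
    (7, (n, ([::], ([::], map g s)))).
Proof.
move=> He s n; rewrite /enc_list foldl_cat.
suff inner out : foldl (pstep pcsp) (1, (n, ([::], ([::], out)))) (flatten [seq true :: e x | x <- s]) =
    (1, (n, ([::], ([::], out ++ map g s)))) by rewrite inner.
elim: s out => [|x s IH] out /=; first by rewrite cats0.
by rewrite foldl_cat He IH -catA.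
Qed.

Definition raw_digraph (G : nat * seq (nat * nat)) : seq bool :=
  enc_unary G.1 ++ enc_list (fun e => enc_nat e.1 ++ enc_nat e.2) G.2.

Definition raw_pcsp (I : nat * seq (nat * seq nat)) : seq bool :=
  enc_unary I.1 ++ enc_list (fun c => enc_nat c.1 ++ enc_list enc_nat c.2) I.2.

Lemma parse_digraph n es :
  parse false (raw_digraph (n, es)) = (n, [seq [:: nat_bits e.1; nat_bits e.2] | e <- es]).
Proof.
rewrite /parse /raw_digraph foldl_cat foldl_pstep_unary.
rewrite (foldl_pstep_list (g := fun e => [:: nat_bits e.1; nat_bits e.2])) // => e m out.
by rewrite foldl_cat !foldl_pstep_nat.
Qed.

Lemma parse_pcsp n cls :
  parse true (raw_pcsp (n, cls)) = (n, [seq nat_bits c.1 :: map nat_bits c.2 | c <- cls]).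
Proof.
rewrite /parse /raw_pcsp foldl_cat foldl_pstep_unary.
rewrite (foldl_pstep_list (g := fun c => nat_bits c.1 :: map nat_bits c.2)) // => -[r vs] m out.
rewrite foldl_cat foldl_pstep_nat //= /enc_list foldl_cat.
suff inner item : foldl (pstep true) (6, (m, ([::], (item, out))))
    (flatten [seq true :: enc_nat x | x <- vs]) = (6, (m, ([::], (item ++ map nat_bits vs, out)))).
  by rewrite inner.
elim: vs item => [|v vs IH] item /=; first by rewrite cats0.
by rewrite foldl_cat foldl_pstep_nat //= IH -catA.
Qed.

(** Increment with the least significant bit first; the second component of the fold is the
    carry. *)
Definition bits_inc (s : seq bool) : seq bool :=
  let r := foldl (fun w b => (w.1 ++ [:: w.2 (+) b], w.2 && b)) ([::], true) s in
  if r.2 then r.1 ++ [:: true] else r.1.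

Lemma bits_incE n : bits_inc (nat_bits n) = nat_bits n.+1.
Proof.
have foldF acc s : foldl (fun w b => (w.1 ++ [:: w.2 (+) b], w.2 && b)) (acc, false) s =
    (acc ++ s, false).
  by elim: s acc => [|b s IH] acc; rewrite /= ?cats0 // IH -catA.
have foldT acc p (r := foldl (fun w b => (w.1 ++ [:: w.2 (+) b], w.2 && b)) (acc, true) (pos_bits p)) :
    (if r.2 then r.1 ++ [:: true] else r.1) = acc ++ pos_bits (Pos.succ p).
  rewrite /r; elim: p acc {r} => [p IH|p IH|] acc /=.
  - by rewrite IH -catA.
  - by rewrite foldF -catA.
  - by rewrite -catA.
rewrite /nat_bits; case E: (N.of_nat n) => [|p].
  by have -> : n = 0 by lia.
have -> : N.of_nat n.+1 = N.pos (Pos.succ p) by lia.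
exact: foldT.
Qed.

Lemma size_nat_bits n : size (nat_bits n) <= n.
Proof.
rewrite /nat_bits; case E: (N.of_nat n) => [|p] //.
have -> : n = Pos.to_nat p by lia.
by elim: p {n E} => //= p IH; lia.
Qed.

Lemma esz_bits (s : seq bool) : esz s <= 4 * size s + 1.
Proof.
elim: s => //= b s IH; rewrite esz_cons /=.
by have le_b : esz b <= 3 by [case: b]; lia.
Qed.

(** Binary digits are found by counting up from zero, which is affordable because the number is
    given in unary. *)
Lemma pt_nat_bits (A : encType) (f : A -> nat) : pt f -> pt (fun a => nat_bits (f a)).
Proof.
move=> Hf; have [p Hp] := pt_size Hf.
have Hinc : pt bits_inc.
  pose st s := foldl (fun w b => (w.1 ++ [:: w.2 (+) b], w.2 && b)) ([::], true) s.
  suff Hst : pt st by apply: pt_if; pt_tac.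
  apply: (pt_foldl (l := id) (f := fun _ w b => (w.1 ++ [:: w.2 (+) b], w.2 && b))
     (g := fun=> ([::], true)) (p := PAdd (PMul (PCst 4) PX) (PCst 10))); pt_tac.
    by apply: (pt_ext (f := fun x : seq bool * (seq bool * bool * bool) =>
      if x.2.1.2 then ~~ x.2.2 else x.2.2)) => [x|]; [case: (x.2.1.2) | pt_tac].
  move=> s k; rewrite -/(st (take k s)).
  have le_st t : size (st t).1 <= size t.
    by elim/last_ind: t => // t b IH; rewrite /st foldl_rcons -/(st t) size_cat size_rcons /= addn1.
  rewrite esz_pair /=; have := esz_bits (st (take k s)).1; have := le_st (take k s).
  have : esz (st (take k s)).2 <= 3 by case: (_.2).
  by have := esz_size s; rewrite size_take_min /=; lia.
have iterE k : iter k bits_inc [::] = nat_bits k.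
  by elim: k => // k IH; rewrite iterS IH bits_incE.
apply: (pt_ext (f := fun a => iter (f a) bits_inc [::])) => // .
apply: (pt_iter (f := fun=> bits_inc) (p := PAdd (PMul (PCst 4) p) (PCst 1))); pt_tac.
  by apply: pt_comp Hinc _; pt_tac.
move=> a k; rewrite iterE /=; have := Hp a; have := esz_bits (nat_bits k); have := size_nat_bits k.
by rewrite esz_nat; lia.
Qed.

Lemma pt_enc_nat (A : encType) (f : A -> nat) : pt f -> pt (fun a => enc_nat (f a)).
Proof. by move=> Hf; rewrite /enc_nat; pt_tac; apply: pt_nat_bits. Qed.

Lemma pt_enc_unary (A : encType) (f : A -> nat) : pt f -> pt (fun a => enc_unary (f a)).
Proof. by move=> Hf; rewrite /enc_unary; pt_tac. Qed.

Lemma pt_enc_list (A B : encType) (e : A -> B -> seq bool) (f : A -> seq B) :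
  pt (fun x : A * B => e x.1 x.2) -> pt f -> pt (fun a => enc_list (e a) (f a)).
Proof.
by move=> He Hf; rewrite /enc_list; pt_tac.
Qed.

Lemma pt_raw_digraph : pt raw_digraph.
Proof.
apply: pt_cat; first by apply: pt_enc_unary; pt_tac.
apply: (pt_enc_list (e := fun _ e => enc_nat e.1 ++ enc_nat e.2)); pt_tac;
  by apply: pt_enc_nat; pt_tac.
Qed.

Lemma pt_raw_pcsp : pt raw_pcsp.
Proof.
apply: pt_cat; first by apply: pt_enc_unary; pt_tac.
apply: (pt_enc_list (e := fun _ c => enc_nat c.1 ++ enc_list enc_nat c.2)); pt_tac.
  by apply: pt_enc_nat; pt_tac.
apply: (pt_enc_list (e := fun _ => enc_nat)); pt_tac.
by apply: pt_enc_nat; pt_tac.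
Qed.

(* Binary to unary; the cap keeps the result small on inputs that do not encode an instance. *)
Definition bits_val (cap : nat) (s : seq bool) : nat :=
  foldl (fun v b => minn cap (v + v + (if b then 1 else 0))) 0 (rev s).

Lemma bits_val_nat cap n : n <= cap -> bits_val cap (nat_bits n) = n.
Proof.
suff -> : bits_val cap (nat_bits n) = minn cap n by lia.
rewrite /bits_val foldl_rev /nat_bits; case E: (N.of_nat n) => [|p].
  by have -> : n = 0; [lia | rewrite /= minn0].
have -> : n = Pos.to_nat p by lia.
elim: p {n E} => [p /= ->|p /= ->|] /=; lia.
Qed.

Lemma pt_bits_val (A : encType) (c : A -> nat) (f : A -> seq bool) :
  pt c -> pt f -> pt (fun a => bits_val (c a) (f a)).
Proof.
move=> Hc Hf; have [p Hp] := pt_size Hc.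
apply: (pt_foldl (f := fun a v b => minn (c a) (v + v + (if b then 1 else 0))) (p := PAdd p (PCst 1)));
  pt_tac.
  by apply: pt_comp Hc _; pt_tac.
move=> a k; elim/last_ind: (take k _) => [|s b _]; first by rewrite /= addn1.
by rewrite foldl_rcons /=; have := Hp a; rewrite !esz_nat; lia.
Qed.

(** * The digraphs *)

Section Construction.
Variables (D : finType) (Gam : seq (prel D)).

Notation relT := 'I_(size Gam).

Definition rel_of (r : relT) : prel D := tnth (in_tuple Gam) r.
Definition ar (r : relT) : nat := pr_ar (rel_of r).
(** The successor guarantees a slot [0] at every vertex, even when all arities are zero. *)
Definition width : nat := (\max_(r : relT) ar r).+1.
Local Notation K := width.

Lemma ar_lt r : ar r < K.
Proof. by rewrite ltnS; apply: leq_bigmax. Qed.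

(* Labels of data-carrying types: a clause of relation [r] (data: a tuple), its
   [i]-th coordinate (data: a value), a variable (data: a value). *)
Definition theta : finType := (relT + relT * 'I_K + unit)%type.
Definition th_cl (r : relT) : theta := inl (inl r).
Definition th_mid (r : relT) (i : 'I_K) : theta := inl (inr (r, i)).
Definition th_var : theta := inr tt.

Definition th_kind (t : theta) : nat :=
  match t with inl (inl _) => 0 | inl (inr _) => 1 | inr _ => 2 end.

(** The kind is the leading digit, so that the arcs from clauses to coordinates to variables go
    forward along the path. *)
Definition code (t : theta) : nat := th_kind t * #|theta| + enum_rank t.

Lemma code_inj : injective code.
Proof.
move=> t t' /(congr1 (modn^~ #|theta|)); rewrite /code !modnMDl !modn_small //.
by move/ord_inj/enum_rank_inj.
Qed.

(** Codes are below [3 * #|theta|], so the upper anchor [code t + 3] of every label is still on the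
    path. *)
Definition depth : nat := 3 * #|theta| + 2.

Lemma code_lt t : (code t).+3 <= depth.
Proof.
have lt_t : enum_rank t < #|theta| := ltn_ord _.
have : th_kind t <= 2 by case: t {lt_t} => [[]|].
rewrite /code /depth; move: (nat_of_ord _) (th_kind t) lt_t => e k.
by move: #|theta| => N; nia.
Qed.

Lemma code_kind t t' : th_kind t < th_kind t' -> code t < code t'.
Proof.
have lt_t : enum_rank t < #|theta| := ltn_ord _.
rewrite /code; move: (nat_of_ord (enum_rank t)) (nat_of_ord (enum_rank t')) lt_t => e e'.
by move: #|theta| (th_kind t) (th_kind t') => N k k'; nia.
Qed.

(* The type digraph: a directed path of [depth] arcs, to which every label [t] is
   anchored by [code t -> t -> code t + 3], together with the arcs
   clause -> coordinate -> variable.  The path is the only longest one. *)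
Definition tp : finType := ('I_depth.+1 + theta)%type.

Definition tarc (x y : tp) : bool :=
  match x, y with
  | inl i, inl j => j == i.+1 :> nat
  | inl i, inr t => i == code t :> nat
  | inr t, inl j => j == (code t).+3 :> nat
  | inr (inl (inl r)), inr (inl (inr (r', i))) => (r == r') && (i < ar r)
  | inr (inl (inr _)), inr (inr _) => true
  | _, _ => false
  end.

(* Two rank functions that strictly increase along arcs and that agree exactly on
   the path. *)
Definition rank1 (x : tp) : nat := match x with inl i => i | inr t => (code t).+1 end.
Definition rank2 (x : tp) : nat := match x with inl i => i | inr t => (code t).+2 end.

Lemma tarc_rank x y : tarc x y -> rank1 x < rank1 y /\ rank2 x < rank2 y.
Proof.
case: x => [i|t]; case: y => [j|t'] /=.
- by move/eqP->.
- by move/eqP->; split; lia.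
- by case: t => [[r|[r i]]|u] /= /eqP->; split; lia.
- have lt_c : th_kind t < th_kind t' -> rank1 (inr t) < rank1 (inr t') /\ rank2 (inr t) < rank2 (inr t').
    by move/code_kind => /= lt_c; split; lia.
  by case: t lt_c => [[r|[r i]]|[]]; case: t' => [[r'|[r' i']]|[]] //= lt_c _; apply: lt_c.
Qed.

Definition pre (B : {set tp}) : {set tp} := [set a | [exists b in B, tarc a b]].
Definition post (A : {set tp}) : {set tp} := [set b | [exists a in A, tarc a b]].

Definition arcU (A B : {set tp}) : bool := [&& A != set0, A \subset pre B & B \subset post A].

Lemma arcU1 x y : tarc x y -> arcU [set x] [set y].
Proof.
move=> xy; apply/and3P; split; first by apply/set0Pn; exists x; rewrite inE.
  by apply/subsetP => z; rewrite !inE => /eqP->; apply/existsP; exists y; rewrite inE eqxx.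
by apply/subsetP => z; rewrite !inE => /eqP->; apply/existsP; exists x; rewrite inE eqxx.
Qed.

Lemma arcU_nonempty A B : arcU A B -> A != set0 /\ B != set0.
Proof.
move=> /and3P[A0 AB _]; split=> //; have /set0Pn[a aA] := A0.
have := subsetP AB _ aA; rewrite inE => /existsP[b /andP[bB _]].
by apply/set0Pn; exists b.
Qed.

Definition label (A : {set tp}) : option theta := [pick t | A == [set (inr t : tp)]].

Lemma labelP A t : label A = Some t <-> A = [set (inr t : tp)].
Proof.
rewrite /label; case: pickP => [t' /eqP->|none]; split.
- by case=> ->.
- by move/set1_inj => [->].
- by [].
- by move=> A1; have := none t; rewrite A1 eqxx.
Qed.

Lemma label1 t : label [set (inr t : tp)] = Some t. Proof. exact/labelP. Qed.

Lemma label_inl i : label [set (inl i : tp)] = None.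
Proof. by case E: label => [t|] //; move/labelP/set1_inj: E. Qed.

(* [i \in slots A B] means that entry [i] of the data at [A] must be the first
   entry of the data at [B]. *)
Definition slots (A B : {set tp}) : seq nat :=
  match label A, label B with
  | Some (inl (inl _)), Some (inl (inr (_, i))) => [:: nat_of_ord i]
  | Some (inl (inr _)), Some (inr _) => [:: 0]
  | _, _ => [::]
  end.

Notation rels := (forall r : relT, {set (ar r).-tuple D}).

Definition fits (S : rels) (A : {set tp}) (s : seq D) : bool :=
  match label A with
  | Some (inl (inl r)) => [exists t in S r, tval t == s]
  | Some _ => size s == 1
  | None => true
  end.

(** Bounded sequences give one finite type for tuples of all arities. Both digraphs have these
    vertices and differ only in their edges. *)
Definition vtx : finType := ({set tp} * K.-bseq D)%type.

(** Conditions on a single vertex have to be imposed by its edges. In particular, a homomorphism may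
    send an isolated vertex anywhere, even to an empty set. *)
Definition edge (S : rels) : rel vtx := fun x y =>
  [&& arcU x.1 y.1, fits S x.1 x.2, fits S y.1 y.2 &
    all (fun i => onth x.2 i == onth y.2 0) (slots x.1 y.1)].

Definition relP : rels := fun r => pr_P (rel_of r).
Definition relQ : rels := fun r => pr_Q (rel_of r).

Lemma fits_sub A s : fits relP A s -> fits relQ A s.
Proof.
rewrite /fits; case: label => [[[r|//]|//]|//] /existsP[t /andP[tP ts]].
by apply/existsP; exists t; rewrite ts andbT (subsetP (pr_PQ (rel_of r))).
Qed.

Lemma edge_sub x y : edge relP x y -> edge relQ x y.
Proof. by move=> /and4P[xy fx fy sl]; apply/and4P; split=> //; apply: fits_sub. Qed.

Lemma fitsP S r s : reflect (tuple_in (S r) s) (fits S [set (inr (th_cl r) : tp)] s).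
Proof.
rewrite /fits label1 /=; apply: (iffP existsP).
  by move=> [t /andP[tS /eqP ts]]; exists t.
by move=> [t [tS ts]]; exists t; rewrite tS; apply/eqP.
Qed.

Definition satS (S : rels) (I : pcsp_inst Gam) : Prop :=
  exists a : 'I_(pi_n I) -> D, forall c, c \in pi_cl I -> tuple_in (S c.1) (map a c.2).

Definition mkvtx (A : {set tp}) (s : seq D) : vtx := (A, insub_bseq K s).

(** * From instances to digraphs *)

Definition anchors (t : theta) (v : nat) : seq (nat * nat) :=
  [:: (code t, v); (v, (code t).+3)].

(** Numbering of the vertices: the path, then the [n] variables, then a block of [K + 1] vertices
    per clause, namely the clause followed by its coordinates. The tail of the block is isolated
    when the arity is smaller than [K]. *)
Definition cl_edges (n c : nat) (vs : seq nat) (r : relT) : seq (nat * nat) :=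
  let vc := depth.+1 + n + c * K.+1 in
  anchors (th_cl r) vc ++
  flatten [seq anchors (th_mid r i) (vc + i.+1) ++
             [:: (vc, vc + i.+1); (vc + i.+1, depth.+1 + nth 0 vs i)] |
           i : 'I_K <- [seq i : 'I_K <- enum 'I_K | i < ar r]].

Definition p2g (I : nat * seq (nat * seq nat)) : nat * seq (nat * nat) :=
  (depth.+1 + I.1 + size I.2 * K.+1,
   [seq (j, j.+1) | j <- iota 0 depth] ++
   flatten [seq anchors th_var (depth.+1 + x) | x <- iota 0 I.1] ++
   flatten [seq (let cl := nth (0, [::]) I.2 c in
                 if insub cl.1 is Some r then cl_edges I.1 c cl.2 r else [::]) |
            c <- iota 0 (size I.2)]).

(** The reductions compute on plain numbers, since parsed words carry no range proofs; ordinals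
    reappear only in the specifications. *)
Definition raw_clauses (I : pcsp_inst Gam) : seq (nat * seq nat) :=
  [seq (val c.1, map val c.2) | c : relT * seq 'I_(pi_n I) <- pi_cl I].

Lemma enc_pcspE (I : pcsp_inst Gam) : enc_pcsp I = raw_pcsp (pi_n I, raw_clauses I).
Proof. by rewrite /enc_pcsp /raw_pcsp /enc_list /raw_clauses /= -map_comp. Qed.

Definition raw_edges (G : in_digraph) : seq (nat * nat) :=
  [seq (val e.1, val e.2) | e : 'I_(dg_n G) * 'I_(dg_n G) <- dg_E G].

Lemma enc_digraphE (G : in_digraph) : enc_digraph G = raw_digraph (dg_n G, raw_edges G).
Proof. by rewrite /enc_digraph /raw_digraph /enc_list /raw_edges /= -map_comp. Qed.

Lemma dg_hom_raw (G : in_digraph) (V : finType) (E : rel V) (v0 : V) :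
  dg_hom G E <-> exists f : nat -> V, forall u v, (u, v) \in raw_edges G -> E (f u) (f v).
Proof.
split=> [[f Hf]|[f Hf]].
  exists (fun k => if insub k is Some i then f i else v0) => u v /mapP[[x y] xyE [-> ->]].
  by rewrite !valK; apply: (Hf (x, y)).
exists (fun i => f i) => e eE; apply: Hf.
by apply/mapP; exists e.
Qed.

Lemma raw_digraph_exists n (es : seq (nat * nat)) :
  all (fun e => (e.1 < n) && (e.2 < n)) es ->
  exists2 G, dg_n G = n & raw_edges G = es.
Proof.
move=> all_es.
suff [E HE] : exists E : seq ('I_n * 'I_n), [seq (val e.1, val e.2) | e <- E] = es.
  by exists (Build_in_digraph E).
elim: es all_es => [|[u v] es IH] /=; first by exists [::].
move=> /andP[/andP[lt_u lt_v] /IH[E <-]].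
by exists ((Ordinal lt_u, Ordinal lt_v) :: E).
Qed.

Lemma raw_pcsp_exists n (cls : seq (nat * seq nat)) :
  all (fun c => (c.1 < size Gam) && all (gtn n) c.2) cls ->
  exists cl : seq (relT * seq 'I_n), [seq (val c.1, map val c.2) | c <- cl] = cls.
Proof.
elim: cls => [|[r vs] cls IH] /=; first by exists [::].
move=> /andP[/andP[lt_r lt_vs] /IH[cl <-]].
suff [us <-] : exists us : seq 'I_n, map val us = vs by exists ((Ordinal lt_r, us) :: cl).
elim: vs lt_vs => [|v vs IHv] /=; first by exists [::].
by move=> /andP[lt_v /IHv[us <-]]; exists (Ordinal lt_v :: us).
Qed.

Definition v0 : vtx := mkvtx set0 [::].

Lemma val_mkvtx A s : size s <= K -> (mkvtx A s).2 = s :> seq D.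
Proof. by move=> le_s; rewrite /= val_insubd le_s. Qed.

(** * Anchors force singletons *)

Section Forcing.
Variable A : nat -> {set tp}.
Hypothesis path_A : forall j, j < depth -> arcU (A j) (A j.+1).

(** By arc consistency [y] ends a chain of [j] arcs and starts one of [depth - j] arcs. Ranks
    increase along arcs and never exceed [depth], so both ranks of [y] equal [j]; on a label they
    would differ. *)
Lemma path_forced j y : j <= depth -> y \in A j -> exists2 i : 'I_depth.+1, y = inl i & i = j :> nat.
Proof.
move=> le_j yA.
have low : j <= rank1 y /\ j <= rank2 y.
  elim: j y le_j yA => // j IH y lt_j yA.
  have /and3P[_ _ /subsetP/(_ _ yA)] := path_A lt_j.
  rewrite inE => /existsP[x /andP[xA /tarc_rank]].
  by have := IH x (ltnW lt_j) xA; lia.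
have high : rank1 y <= j /\ rank2 y <= j.
  rewrite -(subKn le_j) in yA *; move: (depth - j) (leq_subr j depth) yA => k.
  elim: k y {low} => [|k IH] y le_k yA.
    rewrite subn0; case: y yA => [i|t] _ /=; first by have := ltn_ord i; rewrite ltnS.
    by have := code_lt t; lia.
  have lt_k : depth - k.+1 < depth by lia.
  have /and3P[_ /subsetP/(_ _ yA) yB _] := path_A lt_k.
  move: yB; rewrite inE => /existsP[x /andP[xA /tarc_rank]].
  have def_k : (depth - k.+1).+1 = depth - k by lia.
  by rewrite def_k in xA; have := IH x (ltnW le_k) xA; lia.
case: y yA low high => [i|t] _ /= low high; first by exists i => //; lia.
by lia.
Qed.

(** A path vertex between the two anchors would put them at distance 2 instead of 3, and a label
    with lower anchor [code t] is [t] by injectivity of [code]. *)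
Lemma anchored t v : arcU (A (code t)) (A v) -> arcU (A v) (A (code t).+3) -> A v = [set (inr t : tp)].
Proof.
move=> /and3P[_ _ sub1] /and3P[Av0 sub2 _].
have le3 := code_lt t; have le0 : code t <= depth by lia.
have sub : A v \subset [set (inr t : tp)].
  apply/subsetP => y yA; rewrite inE.
  have := subsetP sub1 _ yA; rewrite inE => /existsP[x /andP[/(path_forced le0)[i -> def_i] xy]].
  have := subsetP sub2 _ yA; rewrite inE => /existsP[z /andP[/(path_forced le3)[k -> def_k] yz]].
  case: y xy yz {yA} => [j|t'] /=; first by move=> /eqP-> /eqP; lia.
  by move=> /eqP ti _; rewrite (code_inj (x1 := t') (x2 := t)) // -ti def_i.
have /set0Pn[y yA] := Av0; apply/eqP; rewrite eqEsubset sub sub1set.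
by have := subsetP sub _ yA; rewrite inE => /eqP <-.
Qed.
End Forcing.

Section InstanceToGraph.
Variables (S : rels) (I : pcsp_inst Gam).
Hypothesis wf_I : pcsp_wf I.
Local Notation n := (pi_n I).
Local Notation es := (p2g (n, raw_clauses I)).2.
Local Notation vc c := (depth.+1 + n + c * K.+1).

Lemma p2g_edges u v :
  reflect [\/ exists2 j, j < depth & (u, v) = (j, j.+1),
             exists2 x : 'I_n, true & (u, v) \in anchors th_var (depth.+1 + x) |
             exists c r vs, onth (pi_cl I) c = Some (r, vs) /\
               ((u, v) \in anchors (th_cl r) (vc c) \/
                exists i : 'I_K, i < ar r /\
                  ((u, v) \in anchors (th_mid r i) (vc c + i.+1) \/
                   (u, v) \in [:: (vc c, vc c + i.+1);
                                (vc c + i.+1, depth.+1 + nth 0 (map val vs) i)]))]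
    ((u, v) \in es).
Proof.
rewrite !mem_cat; apply: (iffP or3P) => -[].
- by move/mapP => [j]; rewrite mem_iota => lt_j ->; constructor 1; exists j.
- move/flatten_mapP => [x]; rewrite mem_iota => lt_x uv; constructor 2.
  by exists (Ordinal (lt_x : x < n)).
- move/flatten_mapP => [c]; rewrite mem_iota /= size_map => lt_c uv; constructor 3.
  case E: (onth (pi_cl I) c) => [[r vs]|]; last first.
    by move: (onthTE (pi_cl I) c); rewrite E lt_c.
  have nth_c : nth (0, [::]) (raw_clauses I) c = (val r, map val vs).
    by rewrite -odflt_onth onth_map E.
  rewrite nth_c /= valK mem_cat in uv; exists c, r, vs; split=> //.
  case/orP: uv => [|/flatten_mapP[i]]; first by left.
  rewrite mem_filter mem_cat => /andP[lt_i _] uv; right; exists i; split=> //.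
  by case/orP: uv; [left | right].
- by move=> [j lt_j [-> ->]]; constructor 1; apply/mapP; exists j; rewrite ?mem_iota.
- move=> [x _ uv]; constructor 2; apply/flatten_mapP; exists (val x) => //.
  by rewrite mem_iota /= ltn_ord.
- move=> [c [r [vs [E uv]]]]; constructor 3; apply/flatten_mapP; exists c.
    by rewrite mem_iota size_map /=; have := onthTE (pi_cl I) c; rewrite E.
  have -> : nth (0, [::]) (raw_clauses I) c = (val r, map val vs).
    by rewrite -odflt_onth onth_map E.
  rewrite /= valK mem_cat; apply/orP.
  case: uv => [|[i [lt_i uv]]]; first by left.
  right; apply/flatten_mapP; exists i; first by rewrite mem_filter lt_i mem_enum.
  by rewrite mem_cat; apply/orP.
Qed.

Lemma wf_size c r vs : onth (pi_cl I) c = Some (r, vs) -> size vs = ar r.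
Proof. by move=> E; apply: (wf_I (c := (r, vs))); apply/onthP; exists c. Qed.

Lemma p2g_bound : all (fun e => (e.1 < vc (size (raw_clauses I))) && (e.2 < vc (size (raw_clauses I)))) es.
Proof.
set N := vc _; apply/allP => -[u v] /p2g_edges.
have ltN k : k <= depth -> k < N by rewrite /N; lia.
have anchN t w : w < N -> (u, v) \in anchors t w -> (u < N) && (v < N).
  have := code_lt t => lt_t lt_w; rewrite !inE.
  by case/orP => /eqP[-> ->]; rewrite lt_w /= ?andbT ltN //; lia.
case=> [[j lt_j [-> ->]]|[x _]|[c [r [vs [E uv]]]]].
- by rewrite /= !ltN // ltnW.
- by apply: anchN; rewrite /N; have := ltn_ord x; lia.
have lt_c : c.+1 <= size (raw_clauses I) by rewrite size_map -onthTE E.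
have ltc k : k <= K -> vc c + k < N.
  move=> le_k; apply: (@leq_trans (depth.+1 + n + c.+1 * K.+1)); first by rewrite mulSn; lia.
  by rewrite leq_add2l leq_mul2r lt_c orbT.
case: uv => [|[i [lt_i []]]].
- by apply: anchN; rewrite -[vc c]addn0 ltc.
- by apply: anchN; rewrite ltc.
- have lt_0 : vc c < N by rewrite -[vc c]addn0 ltc.
  have lt_vs : i < size vs by rewrite (wf_size E).
  rewrite !inE => /orP[]/eqP[-> ->]; rewrite ?lt_0 ltc //=.
  have : nth 0 (map val vs) i < n.
    by case: (vs) lt_vs => // w ws lt_vs; rewrite (nth_map w) // ltn_ord.
  move=> lt_nth; apply: (@leq_trans (depth.+1 + n)); last by rewrite /N leq_addr.
  by rewrite ltn_add2l.
Qed.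

Lemma hom_sat (f : nat -> vtx) :
  (forall u v, (u, v) \in es -> edge S (f u) (f v)) -> satS S I.
Proof.
move=> Hf; pose A k := (f k).1.
have arc u v : (u, v) \in es -> arcU (A u) (A v) by move/Hf/and4P => [].
have path_A j : j < depth -> arcU (A j) (A j.+1).
  by move=> lt_j; apply: arc; apply/p2g_edges; constructor 1; exists j.
have anch t v : {subset anchors t v <= es} ->
    A v = [set (inr t : tp)] /\ fits S [set (inr t : tp)] (f v).2.
  move=> sub; have Av : A v = [set (inr t : tp)].
    by apply: (anchored path_A); apply: arc; apply: sub; rewrite !inE eqxx ?orbT.
  split=> //; rewrite -Av; have /sub/Hf/and4P[_ _ ] : (code t, v) \in anchors t v by rewrite !inE eqxx.
  by [].
have Hvar (x : 'I_n) : exists d, (f (depth.+1 + x)).2 = [:: d] :> seq D.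
  have [|_] := anch th_var (depth.+1 + x).
    by move=> [u v] uv; apply/p2g_edges; constructor 2; exists x.
  by rewrite /fits label1 /=; case: ((f _).2 : seq D) => [|d []] //; exists d.
(* The assignment is read off at the vertices of the variables. *)
have [a Ha] := fin_all_exists Hvar.
exists a => -[r vs] /onthP[c E] /=.
have [|Ac Fc] := anch (th_cl r) (vc c).
  by move=> [u v] uv; apply/p2g_edges; constructor 3; exists c, r, vs; split=> //; left.
have /fitsP := Fc; suff -> : (f (vc c)).2 = map a vs :> seq D by [].
have sz_c : size (f (vc c)).2 = ar r.
  by case/fitsP: Fc => t [_ <-]; rewrite size_tuple.
(* Entry [i] of the clause data is compared with the value of the variable through the coordinate
   vertex, along the arcs [cm] and [mx]. *)
apply: eq_from_onth_le => i; rewrite sz_c size_map (wf_size E) maxnn => lt_i.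
have lt_iK : i < K := ltn_trans lt_i (ar_lt r).
pose i' := Ordinal lt_iK.
have [|Am Fm] := anch (th_mid r i') (vc c + i.+1).
  move=> [u v] uv; apply/p2g_edges; constructor 3; exists c, r, vs; split=> //; right.
  by exists i'; split=> //; left.
have cm : (vc c, vc c + i.+1) \in es.
  apply/p2g_edges; constructor 3; exists c, r, vs; split=> //; right.
  by exists i'; split=> //; right; rewrite !inE eqxx.
have mx : (vc c + i.+1, depth.+1 + nth 0 (map val vs) i) \in es.
  apply/p2g_edges; constructor 3; exists c, r, vs; split=> //; right.
  by exists i'; split=> //; right; rewrite !inE eqxx orbT.
have [x def_x] : exists x, onth vs i = Some x.
  by case E': (onth vs i) => [x|]; [exists x | have := onthTE vs i; rewrite E' (wf_size E) lt_i].
have nth_x : nth 0 (map val vs) i = x by rewrite -odflt_onth onth_map def_x.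
rewrite nth_x in mx.
have [|Ax _] := anch th_var (depth.+1 + x).
  by move=> [u v] uv; apply/p2g_edges; constructor 2; exists x.
have /and4P[_ _ _] := Hf _ _ cm; rewrite -/(A _) -/(A (vc c + _)) Ac Am /slots !label1 /= andbT => /eqP ->.
have /and4P[_ _ _] := Hf _ _ mx; rewrite -/(A _) -/(A (depth.+1 + _)) Ax Am /slots !label1 /= andbT => /eqP ->.
by rewrite onth_map def_x Ha.
Qed.
Lemma sat_hom : satS S I ->
  exists f : nat -> vtx, forall u v, (u, v) \in es -> edge S (f u) (f v).
Proof.
move=> [a Ha].
(* [q] is the offset into the clause blocks: the quotient by [K + 1] is the clause, remainder [0] is
   the clause vertex, and remainder [j + 1] is coordinate [j]. *)
pose fcl q : vtx :=
  if onth (pi_cl I) (q %/ K.+1) is Some (r, vs) then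
    if q %% K.+1 is j.+1 then
      mkvtx [set (inr (th_mid r (inord j)) : tp)] (oapp (fun x => [:: a x]) [::] (onth vs j))
    else mkvtx [set (inr (th_cl r) : tp)] (map a vs)
  else v0.
pose f k : vtx :=
  if k < depth.+1 then mkvtx [set (inl (inord k) : tp)] [::]
  else if insub (k - depth.+1) is Some x then mkvtx [set (inr th_var : tp)] [:: a x]
  else fcl (k - (depth.+1 + n)).
have f_path k : k <= depth -> f k = mkvtx [set (inl (inord k) : tp)] [::].
  by rewrite /f ltnS => ->.
have f_var (x : 'I_n) : f (depth.+1 + x) = mkvtx [set (inr th_var : tp)] [:: a x].
  by rewrite /f ltnNge leq_addr /= addKn valK.
have f_cl c j : f (vc c + j) = fcl (c * K.+1 + j).
  have nlt : (vc c + j < depth.+1) = false by lia.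
  rewrite /f nlt insubF; last by lia.
  by congr fcl; lia.
have f_clause c r vs : onth (pi_cl I) c = Some (r, vs) ->
    f (vc c) = mkvtx [set (inr (th_cl r) : tp)] (map a vs).
  move=> E; rewrite -[vc c]addn0 f_cl /fcl addn0 mulnK // E.
  by rewrite modnMl.
have f_mid c r vs (i : 'I_K) x : onth (pi_cl I) c = Some (r, vs) -> onth vs i = Some x ->
    f (vc c + i.+1) = mkvtx [set (inr (th_mid r i) : tp)] [:: a x].
  move=> E Ex; rewrite f_cl /fcl divnMDl // modnMDl.
  have lt_i : i.+1 < K.+1 by rewrite ltnS.
  by rewrite divn_small // modn_small // addn0 E inord_val Ex.
have fitsK c r vs : onth (pi_cl I) c = Some (r, vs) -> size (map a vs) <= K.
  by move=> E; rewrite size_map (wf_size E) ltnW // ar_lt.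
have edgeI x y (s t : seq D) : tarc x y -> size s <= K -> size t <= K ->
    fits S [set x] s -> fits S [set y] t ->
    all (fun i => onth s i == onth t 0) (slots [set x] [set y]) ->
    edge S (mkvtx [set x] s) (mkvtx [set y] t).
  by move=> xy les let_ fs ft sl; rewrite /edge !val_mkvtx // fs ft sl /= arcU1.
have anch t (s : seq D) w : f w = mkvtx [set (inr t : tp)] s -> size s <= K ->
    fits S [set (inr t : tp)] s ->
    forall u v, (u, v) \in anchors t w -> edge S (f u) (f v).
  move=> fw les fs u v; have lt_t := code_lt t.
  rewrite !inE => /orP[]/eqP[-> ->]; rewrite fw f_path; try lia; apply: edgeI => //=.
  - by rewrite inordK //; lia.
  - by rewrite /fits label_inl.
  - by rewrite /slots label_inl.
  - by rewrite inordK; [case: (t) => [[r|[r i]]|u'] | lia].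
  - by rewrite /fits label_inl.
  - by rewrite /slots label_inl; case: label => // -[[r|[r i]]|u'].
exists f => u v /p2g_edges[[j lt_j [-> ->]]|[x _]|[c [r [vs [E uv]]]]].
- rewrite !f_path //; last exact: ltnW.
  apply: edgeI => //; rewrite /fits /slots ?label_inl //.
  by rewrite /tarc !inordK // ltnS ltnW.
- by apply: anch (f_var x) _ _ _ _; rewrite ?/fits ?label1.
have fit_c : fits S [set (inr (th_cl r) : tp)] (map a vs).
  by apply/fitsP; apply: (Ha (r, vs)); apply/onthP; exists c.
case: uv => [|[i [lt_i uv]]]; first exact: anch (f_clause _ _ _ E) (fitsK _ _ _ E) fit_c _ _.
have [x def_x] : exists x, onth vs i = Some x.
  by case E': (onth vs i) => [x|]; [exists x | have := onthTE vs i; rewrite E' (wf_size E) lt_i].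
have nth_x : nth 0 (map val vs) i = x by rewrite -odflt_onth onth_map def_x.
have f_m := f_mid _ _ _ _ _ E def_x.
case: uv; first by apply: anch f_m _ _ _ _; rewrite ?/fits ?label1.
rewrite !inE nth_x => /orP[]/eqP[-> ->]; rewrite f_m ?(f_clause _ _ _ E) ?f_var; apply: edgeI => //.
- by rewrite /= eqxx.
- exact: fitsK E.
- by rewrite /fits label1.
- by rewrite /slots !label1 /= onth_map def_x eqxx.
- by rewrite /fits label1.
- by rewrite /fits label1.
- by rewrite /slots !label1 /= eqxx.
Qed.
End InstanceToGraph.

End Construction.

(** * Merging variables *)

(** The table [s] maps each variable to the representative of its class; merging relabels one whole
    class, as in the quick-find algorithm. *)
Definition vmerge (s : seq nat) (pq : nat * nat) : seq nat :=
  [seq if l == nth 0 s pq.2 then nth 0 s pq.1 else l | l <- s].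

Definition vmerge_all (N : nat) (ps : seq (nat * nat)) : seq nat := foldl vmerge (iota 0 N) ps.

Lemma size_vmerge s ps : size (foldl vmerge s ps) = size s.
Proof. by elim: ps s => //= pq ps IH s; rewrite IH size_map. Qed.

Lemma nth_vmerge s pq p : p < size s ->
  nth 0 (vmerge s pq) p = if nth 0 s p == nth 0 s pq.2 then nth 0 s pq.1 else nth 0 s p.
Proof. by move=> lt_p; rewrite (nth_map 0). Qed.

Lemma vmerge_lt N s ps : 0 < N -> all (gtn N) s -> all (gtn N) (foldl vmerge s ps).
Proof.
move=> N0; elim: ps s => //= pq ps IH s lt_s; apply: IH; rewrite all_map.
apply: (sub_all _ lt_s) => l lt_l /=; case: ifP => // _.
have [lt_p|ge_p] := ltnP pq.1 (size s); last by rewrite nth_default.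
by apply: (allP lt_s); rewrite mem_nth.
Qed.

Lemma vmerge_eq s ps pq :
  (forall p, p \in ps -> (p.1 < size s) && (p.2 < size s)) -> pq \in ps ->
  nth 0 (foldl vmerge s ps) pq.1 = nth 0 (foldl vmerge s ps) pq.2.
Proof.
(* Variables once merged stay merged. *)
have keep qs t i j : i < size t -> j < size t -> nth 0 t i = nth 0 t j ->
    nth 0 (foldl vmerge t qs) i = nth 0 (foldl vmerge t qs) j.
  elim: qs t => //= q qs IH t lt_i lt_j eq_ij.
  by apply: IH; rewrite ?size_map // !nth_vmerge // eq_ij.
elim: ps s => //= p ps IH s lt_ps; rewrite inE => /predU1P[->|pq_ps].
  have /andP[lt1 lt2] := lt_ps p (mem_head _ _).
  by apply: keep; rewrite ?size_map // !nth_vmerge // eqxx; case: eqP.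
by apply: IH => // q q_ps; rewrite size_map; apply: lt_ps; rewrite inE q_ps orbT.
Qed.

(** Only variables forced to be equal are merged, so a valuation that respects the equalities does
    not distinguish a variable from its representative. *)
Lemma vmerge_inv (X : Type) (sg : nat -> X) N ps :
  (forall p, p \in ps -> (p.1 < N) && (p.2 < N)) ->
  (forall p, p \in ps -> sg p.1 = sg p.2) ->
  forall i, i < N -> sg (nth 0 (vmerge_all N ps) i) = sg i.
Proof.
move=> lt_ps eq_ps; rewrite /vmerge_all.
suff gen s : size s = N -> (forall i, i < N -> sg (nth 0 s i) = sg i) ->
    forall i, i < N -> sg (nth 0 (foldl vmerge s ps) i) = sg i.
  by apply: gen => [|i lt_i]; rewrite ?size_iota // nth_iota.
elim: ps s lt_ps eq_ps => //= p ps IH s lt_ps eq_ps sz_s inv_s.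
have /andP[lt1 lt2] := lt_ps p (mem_head _ _).
apply: IH; rewrite ?size_map //; first by move=> q qs; apply: lt_ps; rewrite inE qs orbT.
  by move=> q qs; apply: eq_ps; rewrite inE qs orbT.
move=> i lt_i; rewrite nth_vmerge ?sz_s //; case: eqP => [eq_i|_]; last exact: inv_s.
by rewrite inv_s // eq_ps ?mem_head // -(inv_s p.2) // -eq_i inv_s.
Qed.

(** * From digraphs to instances *)

Section GraphToInstance.
Variables (D : finType) (Gam : seq (prel D)).
Notation relT := 'I_(size Gam).
Notation tp := (tp Gam).
Notation K := (width Gam).

Definition lab (L : seq {set tp}) (i : nat) : {set tp} := nth set0 L i.

Definition ac_step (n : nat) (L : seq {set tp}) (e : nat * nat) : seq {set tp} :=
  [seq (lab L i :&: (if i == e.1 then pre (lab L e.2) else setT))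
         :&: (if i == e.2 then post (lab L e.1) else setT) | i <- iota 0 n].

(** A round that changes anything removes at least one type from some set. The sets start with
    [n * #|tp|] elements in total ([mass]), so this many rounds reach a fixed point. *)
Definition ac (n : nat) (es : seq (nat * nat)) : seq {set tp} :=
  iter (n * #|tp|) (fun L => foldl (ac_step n) L es) (nseq n setT).

Lemma size_ac_step n L e : size (ac_step n L e) = n.
Proof. by rewrite size_map size_iota. Qed.

Lemma lab_ac_step n L e i : i < n -> lab (ac_step n L e) i =
  (lab L i :&: (if i == e.1 then pre (lab L e.2) else setT))
    :&: (if i == e.2 then post (lab L e.1) else setT).
Proof. by move=> lt_i; rewrite /lab (nth_map 0) ?size_iota // nth_iota. Qed.

Definition mass (n : nat) (L : seq {set tp}) : nat := \sum_(i < n) #|lab L i|.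

Lemma ac_step_mass n L e : size L = n ->
  ac_step n L e = L \/ mass n (ac_step n L e) < mass n L.
Proof.
move=> sz_L; have sub i : i < n -> lab (ac_step n L e) i \subset lab L i.
  by move=> lt_i; rewrite lab_ac_step // -setIA subsetIl.
have [le_m eq_m] : mass n (ac_step n L e) <= mass n L ?=
    iff [forall i : 'I_n, lab L i \subset lab (ac_step n L e) i].
  by apply: leqif_sum => i _; apply: subset_leqif_card; apply: sub.
case: (boolP [forall i : 'I_n, _]) eq_m => [/forallP all_i _|_ /negbT neq].
  left; apply: (@eq_from_nth _ set0) => [|i]; rewrite size_ac_step ?sz_L // => lt_i.
  by apply/eqP; rewrite eqEsubset [_ \subset _]sub //=; exact: (all_i (Ordinal lt_i)).
by right; rewrite ltn_neqAle neq.
Qed.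

Lemma foldl_ac_mass n es L : size L = n ->
  {in es, forall e, ac_step n L e = L} \/ mass n (foldl (ac_step n) L es) < mass n L.
Proof.
elim: es L => [|e es IH] L sz_L; first by left.
have [eqL|ltL] := ac_step_mass e sz_L.
  rewrite /= eqL; have [all_es|lt_m] := IH L sz_L; last by right.
  by left=> e'; rewrite inE => /predU1P[->|/all_es].
right=> /=; apply: leq_ltn_trans ltL; have [all_es|/ltnW//] := IH _ (size_ac_step n L e).
suff -> : foldl (ac_step n) (ac_step n L e) es = ac_step n L e by [].
elim: es all_es {IH} => //= e' es IH all_es; rewrite all_es ?mem_head // IH // => e2 e2es.
by apply: all_es; rewrite inE e2es orbT.
Qed.

Lemma foldl_ac_size n es L : size L = n -> size (foldl (ac_step n) L es) = n.
Proof. by elim: es L => //= e es IH L _; rewrite IH // size_ac_step. Qed.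

Lemma foldl_ac_fix n es L : {in es, forall e, ac_step n L e = L} -> foldl (ac_step n) L es = L.
Proof.
elim: es => //= e es IH all_es; rewrite all_es ?mem_head // IH // => e' e'es.
by apply: all_es; rewrite inE e'es orbT.
Qed.

Lemma ac_fix n es : {in es, forall e, ac_step n (ac n es) e = ac n es}.
Proof.
rewrite /ac; pose F L := foldl (ac_step n) L es.
have gen N L : size L = n -> mass n L <= N ->
    {in es, forall e, ac_step n (iter N F L) e = iter N F L}.
  elim: N L => [|N IH] L sz_L le_N; have [fixL|ltL] := foldl_ac_mass es sz_L => //.
  - by move: ltL; rewrite (eqP (_ : mass n L == 0)) -?leqn0.
  - by rewrite (_ : iter N.+1 F L = L) //; elim: N.+1 => //= k ->; apply: foldl_ac_fix.
  - by rewrite iterSr; apply: IH; rewrite ?foldl_ac_size // -ltnS; apply: leq_trans ltL le_N.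
apply: (gen _ (nseq n setT)); first by rewrite size_nseq.
rewrite /mass (eq_bigr (fun=> #|tp|)) ?sum_nat_const ?card_ord // => i _.
by rewrite /lab nth_nseq ltn_ord cardsT.
Qed.

Lemma ac_consistent n es u v : (u, v) \in es -> u < n -> v < n ->
  lab (ac n es) u \subset pre (lab (ac n es) v) /\ lab (ac n es) v \subset post (lab (ac n es) u).
Proof.
move=> uv lt_u lt_v; have /= fixE := ac_fix n uv.
split.
  by rewrite -{1}fixE lab_ac_step // eqxx; apply/subsetP => y; rewrite !in_setI => /andP[/andP[]].
by rewrite -{1}fixE lab_ac_step // eqxx; apply/subsetP => y; rewrite !in_setI => /andP[].
Qed.

Lemma pre_sub (A B : {set tp}) : A \subset B -> pre A \subset pre B.
Proof.
move=> sub; apply/subsetP => x; rewrite !inE => /existsP[y /andP[yA xy]].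
by apply/existsP; exists y; rewrite (subsetP sub).
Qed.

Lemma post_sub (A B : {set tp}) : A \subset B -> post A \subset post B.
Proof.
move=> sub; apply/subsetP => x; rewrite !inE => /existsP[y /andP[yA xy]].
by apply/existsP; exists y; rewrite (subsetP sub).
Qed.

(** [pre] and [post] are monotone, so an arc-consistent family inside the current sets survives each
    restriction. *)
Lemma ac_largest n es (A : nat -> {set tp}) :
  all (fun e => (e.1 < n) && (e.2 < n)) es ->
  (forall u v, (u, v) \in es -> arcU (A u) (A v)) ->
  forall i, i < n -> A i \subset lab (ac n es) i.
Proof.
move=> /allP lt_es arc.
have step L e : e \in es -> (forall i, i < n -> A i \subset lab L i) ->
    forall i, i < n -> A i \subset lab (ac_step n L e) i.
  case: e => u v uv subL i lt_i; rewrite lab_ac_step // !subsetI subL //=.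
  have /andP[/= lt_u lt_v] := lt_es _ uv.
  have /and3P[_ sub1 sub2] := arc _ _ uv.
  apply/andP; split; case: eqP => [->|_]; rewrite ?subsetT //.
    exact: subset_trans sub1 (pre_sub (subL _ lt_v)).
  exact: subset_trans sub2 (post_sub (subL _ lt_u)).
rewrite /ac; elim: (n * _) => [|k IH] /=.
  by move=> i lt_i; rewrite /lab nth_nseq lt_i subsetT.
move: IH; move: (iter k _ _) => L.
have : {subset es <= es} by [].
elim: {1 3}es L => //= e es' IH L sub IHL; apply: IH; last by apply: step IHL; rewrite sub ?mem_head.
by move=> e' e's; apply: sub; rewrite inE e's orbT.
Qed.

(** A homomorphism tells nothing about its isolated vertices. This is harmless because the full set
    is neither empty nor a label. *)
Lemma ac_isolated n es i : i < n -> (forall u v, (u, v) \in es -> i != u /\ i != v) ->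
  lab (ac n es) i = setT.
Proof.
move=> lt_i iso; rewrite /ac; elim: (n * _) => [|k IH] /=; first by rewrite /lab nth_nseq lt_i.
move: IH; move: (iter k _ _) => L.
elim: es iso L => //= -[u v] es IH iso L IHL; apply: IH => [u' v' uv'|].
  by apply: iso; rewrite inE uv' orbT.
have [/negbTE nu /negbTE nv] := iso u v (mem_head _ _).
by rewrite lab_ac_step //= nu nv !setIT.
Qed.

Definition clause_of (A : {set tp}) : seq nat :=
  if label A is Some (inl (inl r)) then [:: nat_of_ord r] else [::].

(** Vertices whose data must contain a value, so that they witness [D] nonempty; a clause of arity
    zero does not. *)
Definition needy (A : {set tp}) : bool :=
  match label A with
  | Some (inl (inl r)) => 0 < ar r
  | Some _ => true
  | None => false
  end.

Definition arity (r : nat) : nat := if insub r is Some r then ar (r : relT) else 0.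

(** Entry [i] of the data at vertex [v] becomes variable [v * K + i]. *)
Definition slot_pairs (es : seq (nat * nat)) (L : seq {set tp}) : seq (nat * nat) :=
  flatten [seq [seq (e.1 * K + i, e.2 * K) | i <- slots (lab L e.1) (lab L e.2)] | e <- es].

Definition g2p_clauses (n : nat) (L : seq {set tp}) (m : seq nat) : seq (nat * seq nat) :=
  flatten [seq [seq (r, [seq nth 0 m (v * K + i) | i <- iota 0 (arity r)]) |
                r <- clause_of (lab L v)] | v <- iota 0 n].

(* With [D] empty, superfluous variables would make the instance unsatisfiable. *)
Definition g2p_size (n : nat) (L : seq {set tp}) : nat :=
  if has (fun i => needy (lab L i)) (iota 0 n) then n * K else 0.

Definition g2p (w0 : seq bool) (G : nat * seq (nat * nat)) : seq bool :=
  let L := ac G.1 G.2 in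
  if has (fun i => lab L i == set0) (iota 0 G.1) then w0
  else raw_pcsp (g2p_size G.1 L, g2p_clauses G.1 L (vmerge_all (G.1 * K) (slot_pairs G.2 L))).

Lemma slots_lt (A B : {set tp}) i : i \in slots A B -> i < K.
Proof.
rewrite /slots; case: (label A) => [[[r|[r j]]|u]|] //; case: (label B) => [[[r'|[r' j']]|u']|] //;
  rewrite inE => /eqP-> //.
Qed.

Lemma slots_label (A B : {set tp}) i : i \in slots A B -> label A /\ label B.
Proof.
by rewrite /slots; case: (label A) => [[[r|[r j]]|u]|] //; case: (label B) => [[[r'|[r' j']]|u']|].
Qed.

Lemma arityE (r : relT) : arity r = ar r. Proof. by rewrite /arity valK. Qed.

Variable G : in_digraph.
Local Notation n := (dg_n G).
Local Notation es := (raw_edges G).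
Local Notation L := (ac n es).
Local Notation ps := (slot_pairs es L).
Local Notation m := (vmerge_all (n * K) ps).

Lemma raw_edges_lt : all (fun e => (e.1 < n) && (e.2 < n)) es.
Proof. by apply/allP => _ /mapP[[x y] _ ->] /=; rewrite !ltn_ord. Qed.

Lemma edge_lt u v : (u, v) \in es -> u < n /\ v < n.
Proof. by move/(allP raw_edges_lt)/andP. Qed.

Lemma slot_lt u i : u < n -> i < K -> u * K + i < n * K.
Proof. by move=> lt_u lt_i; apply: (@leq_trans (u.+1 * K)); rewrite ?leq_mul2r ?lt_u ?orbT // mulSn; lia. Qed.

Lemma slot_pairsP p : reflect (exists u v i, [/\ (u, v) \in es, i \in slots (lab L u) (lab L v) &
  p = (u * K + i, v * K)]) (p \in ps).
Proof.
apply: (iffP flatten_mapP) => [[[u v] uv /mapP[i iS ->]]|[u [v [i [uv iS ->]]]]].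
  by exists u, v, i.
by exists (u, v) => //; apply/mapP; exists i.
Qed.

Lemma slot_pairs_lt p : p \in ps -> (p.1 < n * K) && (p.2 < n * K).
Proof.
move=> /slot_pairsP[u [v [i [uv iS ->]]]] /=; have [lt_u lt_v] := edge_lt uv.
by rewrite slot_lt ?(slots_lt iS) // -[v * K]addn0 slot_lt.
Qed.

Lemma g2p_clausesP (r : nat) (us : seq nat) : reflect (exists v (r' : relT),
  [/\ v < n, label (lab L v) = Some (th_cl r'), r = r' :> nat &
      us = [seq nth 0 m (v * K + i) | i <- iota 0 (ar r')]]) ((r, us) \in g2p_clauses n L m).
Proof.
apply: (iffP flatten_mapP) => [[v]|[v [r' [lt_v lv -> ->]]]].
  rewrite mem_iota /= => lt_v /mapP[r0]; rewrite /clause_of.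
  case lv: label => [[[r'|//]|//]|//]; rewrite inE => /eqP-> [-> ->].
  by exists v, r'; split; rewrite ?arityE.
exists v; first by rewrite mem_iota.
by apply/mapP; exists (val r'); rewrite ?arityE // /clause_of lv mem_head.
Qed.

Lemma needy_size v : v < n -> needy (lab L v) -> g2p_size n L = n * K.
Proof.
move=> lt_v nv; rewrite /g2p_size; case: hasP => // -[]; exists v => //.
by rewrite mem_iota.
Qed.

Lemma merged_lt p : 0 < n -> p < n * K -> nth 0 m p < n * K.
Proof.
move=> n0 lt_p; have nK0 : 0 < n * K by rewrite muln_gt0 n0.
have /allP lt_m : all (gtn (n * K)) m.
  by apply: vmerge_lt => //; apply/allP => i; rewrite mem_iota.
by apply: lt_m; rewrite mem_nth // size_vmerge size_iota.
Qed.

Lemma g2p_inst : exists I : pcsp_inst Gam,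
  [/\ pi_n I = g2p_size n L, raw_clauses I = g2p_clauses n L m & pcsp_wf I].
Proof.
have [|cl Hcl] := @raw_pcsp_exists _ Gam (g2p_size n L) (g2p_clauses n L m).
  apply/allP => -[r us] /g2p_clausesP[v [r' [lt_v lv -> ->]]] /=; rewrite ltn_ord /=.
  apply/allP => z /mapP[i]; rewrite mem_iota /= => lt_i ->.
  rewrite /= (needy_size lt_v); last by rewrite /needy lv /=; lia.
  by rewrite merged_lt ?slot_lt //; [lia | exact: ltn_trans lt_i (ar_lt r')].
exists (@Build_pcsp_inst _ Gam _ cl); split=> // -[r us] c_cl /=.
have /g2p_clausesP : (val r, map val us) \in g2p_clauses n L m.
  by rewrite -Hcl; apply/mapP; exists (r, us).
move=> [v [r' [_ _ /val_inj -> /(congr1 size)]]].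
by rewrite !size_map size_iota.
Qed.

Section Correct.
Variables (S : forall r : relT, {set (ar r).-tuple D}) (I : pcsp_inst Gam).
Hypotheses (nI : pi_n I = g2p_size n L) (clI : raw_clauses I = g2p_clauses n L m).

Lemma g2p_sat (f : nat -> vtx Gam) : (forall u v, (u, v) \in es -> edge S (f u) (f v)) ->
  ~~ has (fun i => lab L i == set0) (iota 0 n) /\ satS S I.
Proof.
move=> Hf; pose A i := (f i).1.
have arc u v : (u, v) \in es -> arcU (A u) (A v) by move/Hf/and4P => [].
have sub := ac_largest raw_edges_lt arc.
have touch i : i < n -> lab L i = setT \/ (A i != set0 /\ fits S (A i) (f i).2).
  move=> lt_i; case: (boolP (has (fun e => (i == e.1) || (i == e.2)) es)).
    move=> /hasP[[u v] uv /= iuv]; right.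
    have /and4P[/arcU_nonempty[Au Av] fu fv _] := Hf _ _ uv.
    by case/orP: iuv => /eqP->.
  move=> /hasPn iso; left; apply: ac_isolated => // u v /iso /=.
  by rewrite negb_or => /andP.
(* A nonempty subset of a singleton is that singleton, so at labelled vertices the homomorphism uses
   exactly the computed set. *)
have lbl i t : i < n -> label (lab L i) = Some t -> A i = lab L i /\ fits S (lab L i) (f i).2.
  move=> lt_i /labelP lt; have [LT|[/set0Pn[y yA] fi]] := touch i lt_i.
    have : (inl ord0 : tp) \in [set (inr t : tp)] by rewrite -lt LT inE.
    by rewrite inE.
  have AL : A i = lab L i.
    have sub_i := sub i lt_i; apply/eqP; rewrite eqEsubset sub_i lt sub1set.
    by have := subsetP sub_i _ yA; rewrite lt inE => /eqP <-.
  by rewrite -AL.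
split.
  apply/hasPn => i; rewrite mem_iota /= => lt_i; apply/set0Pn.
  have [->|[/set0Pn[y yA] _]] := touch i lt_i; first by exists (inl ord0); rewrite inE.
  by exists y; apply: subsetP yA; apply: sub.
pose sg p : option D := onth (f (p %/ K)).2 (p %% K).
have sgE u i : i < K -> sg (u * K + i) = onth (f u).2 i.
  by move=> lt_i; rewrite /sg divnMDl // modnMDl divn_small // modn_small // addn0.
have sg_ps p : p \in ps -> sg p.1 = sg p.2.
  move=> /slot_pairsP[u [v [i [uv iS ->]]]] /=; have [lt_u lt_v] := edge_lt uv.
  rewrite -[v * K]addn0 !sgE ?(slots_lt iS) //.
  have [] := slots_label iS; case lu: (label (lab L u)) => [t|//] _.
  case lv: (label (lab L v)) => [t'|//] _.
  have [Au _] := lbl u t lt_u lu; have [Av _] := lbl v t' lt_v lv.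
  have /and4P[_ _ _ /allP] := Hf _ _ uv; rewrite -/(A u) -/(A v) Au Av => sl.
  exact/eqP/sl.
have sg_m := vmerge_inv slot_pairs_lt sg_ps.
(* Slots without data receive an arbitrary value. If [D] is empty, a needy vertex would have to
   contain a value, so there are no variables at all. *)
have [a Ha] : exists a : 'I_(pi_n I) -> D, forall p d, sg (val p) = Some d -> a p = d.
  have [d0 _|D0] := pickP (fun _ : D => true).
    by exists (fun p => odflt d0 (sg (val p))) => p d ->.
  suff n0 : pi_n I = 0.
    have noI (p : 'I_(pi_n I)) : False by case: p => p; rewrite n0.
    by exists (fun p => False_rect D (noI p)) => p; case: (noI p).
  rewrite nI /g2p_size; case: hasP => // -[v]; rewrite mem_iota /= => lt_v.
  rewrite /needy; case lv: label => [t|//] nt; have [_] := lbl v t lt_v lv.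
  rewrite /fits lv; case: ((f v).2 : seq D) => [|d ?]; last by have := D0 d.
  case: t lv nt => [[r|[r i]]|u] //= _ r0 /existsP[t /andP[_ /eqP t0]].
  by have := size_tuple t; rewrite t0 /=; lia.
exists a => -[r vs] c_cl.
have /g2p_clausesP : (val r, map val vs) \in g2p_clauses n L m.
  by rewrite -clI; apply/mapP; exists (r, vs).
move=> [v [r' [lt_v lv /val_inj E us]]]; rewrite -{r'}E in lv us.
have [Av] := lbl v _ lt_v lv; rewrite /=.
have /labelP -> := lv; move/fitsP; suff -> : (f v).2 = map a vs :> seq D by [].
have sz_vs : size vs = ar r by have := congr1 size us; rewrite !size_map size_iota.
have sz_f : size (f v).2 = ar r.
  have [_] := lbl v _ lt_v lv; have /labelP -> := lv.
  by move/fitsP => [t [_ <-]]; rewrite size_tuple.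
apply: eq_from_onth_le => i; rewrite size_map sz_vs sz_f maxnn => lt_i.
have lt_iK := ltn_trans lt_i (ar_lt r).
have [d def_d] : exists d, onth (f v).2 i = Some d.
  by case E: (onth _ i) => [d|]; [exists d | have := onthTE (f v).2 i; rewrite E sz_f lt_i].
have [x def_x] : exists x, onth vs i = Some x.
  by case E: (onth vs i) => [x|]; [exists x | have := onthTE vs i; rewrite E sz_vs lt_i].
rewrite onth_map def_d def_x /=; congr Some; apply/esym/Ha; rewrite -def_d.
have -> : val x = nth 0 m (v * K + i).
  have <- : nth 0 (map val vs) i = val x by rewrite -odflt_onth onth_map def_x.
  by rewrite us (nth_map 0) ?size_iota // nth_iota.
by rewrite sg_m ?sgE // slot_lt.
Qed.

Lemma sat_g2p : ~~ has (fun i => lab L i == set0) (iota 0 n) -> satS S I ->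
  exists f : nat -> vtx Gam, forall u v, (u, v) \in es -> edge S (f u) (f v).
Proof.
move=> /hasPn ne [a Ha].
(* Partial, because the instance has no variables when no vertex is needy; [dtE] shows that all
   entries are defined otherwise. *)
pose aO p : option D := omap a (insub p).
have aO_val us : pmap aO (map val us) = map a us.
  by elim: us => //= x us IH; rewrite /aO valK /= -/aO IH.
pose dt u k := pmap aO [seq nth 0 m (u * K + j) | j <- iota 0 k].
have dtE u k i : u < n -> k <= K -> g2p_size n L = n * K -> i < k ->
    size (dt u k) = k /\ onth (dt u k) i = aO (nth 0 m (u * K + i)).
  move=> lt_u le_k szE lt_i.
  have def_us : map Some (dt u k) = [seq aO (nth 0 m (u * K + j)) | j <- iota 0 k].
    rewrite /dt [in RHS](map_comp aO); set us := [seq nth _ _ _ | j <- _].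
    have : all (gtn (n * K)) us.
      apply/allP => z /mapP[j]; rewrite mem_iota /= => lt_j ->.
      by rewrite /= merged_lt ?slot_lt //; lia.
    elim: us => //= p us IH /andP[lt_p /IH <-].
    by rewrite /aO -nI in szE *; rewrite -szE in lt_p; rewrite insubT.
  split; first by have := congr1 size def_us; rewrite !size_map size_iota.
  have := congr1 (fun s => onth s i) def_us; rewrite !onth_map.
  have -> : onth (iota 0 k) i = Some i by rewrite onthE (nth_map 0) ?size_iota // nth_iota.
  by case: (onth (dt u k) i) => //= d [<-].
pose arl (A : {set tp}) := match label A with
  | Some (inl (inl r)) => ar r | Some _ => 1 | None => 0 end.
have arlK A : arl A <= K.
  by rewrite /arl; case: label => [[[r|//]|//]|//]; exact: ltnW (ar_lt r).
exists (fun u => mkvtx (lab L u) (dt u (arl (lab L u)))) => u v uv.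
have [lt_u lt_v] := edge_lt uv.
have sz_dt w k : k <= K -> size (dt w k) <= K.
  by move=> le_k; rewrite /dt size_pmap (leq_trans (count_size _ _)) // size_map size_iota.
have fit w : w < n -> fits S (lab L w) (dt w (arl (lab L w))).
  move=> lt_w; case lw: (label (lab L w)) => [[[r|[r i]]|x]|]; rewrite /arl lw; last by rewrite /fits lw.
  - have /labelP -> := lw; apply/fitsP.
    have : (val r, [seq nth 0 m (w * K + i) | i <- iota 0 (ar r)]) \in g2p_clauses n L m.
      by apply/g2p_clausesP; exists w, r.
    rewrite -clI => /mapP[[r' vs] c_cl [/val_inj E us]]; move: (Ha _ c_cl); rewrite /= -E.
    by rewrite /dt us aO_val.
  - have szE : g2p_size n L = n * K by apply: (needy_size lt_w); rewrite /needy lw.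
    by rewrite /fits lw; have [-> _] := dtE w 1 0 lt_w isT szE isT.
  - have szE : g2p_size n L = n * K by apply: (needy_size lt_w); rewrite /needy lw.
    by rewrite /fits lw; have [-> _] := dtE w 1 0 lt_w isT szE isT.
have arc : arcU (lab L u) (lab L v).
  have [sub1 sub2] := ac_consistent uv lt_u lt_v.
  by rewrite /arcU sub1 sub2 ne ?mem_iota.
rewrite /edge !val_mkvtx ?sz_dt // !fit //= arc /=.
apply/allP => i iS; apply/eqP.
(* For a clause followed by a coordinate, the bound on [i] comes from [tarc]: consistency of the two
   singletons makes them adjacent types, and such a coordinate is below the arity. *)
have : i < arl (lab L u) /\ arl (lab L v) = 1.
  move: iS; rewrite /slots /arl.
  case lu: label => [[[r|[r j]]|x]|] //; case lv: label => [[[r'|[r' j']]|x']|] //; last first.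
    by rewrite inE => /eqP->.
  rewrite inE => /eqP->; split=> //.
  move: arc => /and3P[_ /subsetP sub1 _]; move/labelP: lu => lu; move/labelP: lv => lv.
  have := sub1 (inr (th_cl r)); rewrite lu lv !inE eqxx => /(_ isT)/existsP[y].
  by rewrite inE => /andP[/eqP-> /= /andP[]].
move=> [lt_i arv]; rewrite arv.
have szE : g2p_size n L = n * K.
  by apply: (needy_size lt_u); move: lt_i; rewrite /needy /arl; case: label => [[[r|[r j]]|x]|] //; lia.
have [_ ->] := dtE u _ i lt_u (arlK _) szE lt_i.
have [_ /= ->] := dtE v 1 0 lt_v isT szE isT.
congr aO; rewrite addn0.
apply: (@vmerge_eq (iota 0 (n * K)) ps (u * K + i, v * K)).
  by move=> p /slot_pairs_lt; rewrite size_iota.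
by apply/slot_pairsP; exists u, v, i.
Qed.
End Correct.
End GraphToInstance.

(** * The reductions run in polynomial time *)

(** [F] is arbitrary: its finite table is built into the program. Thus [pre], [post], [slots] and
    [label] never have to be programmed. *)
Lemma pt_set1 (T : finType) (A B : encType) (F : {set T} -> B) (f : A -> {set T}) :
  pt f -> pt (fun a => F (f a)).
Proof. by apply: (pt_setcase (f := fun X _ => F X)) => X; apply: pt_cst. Qed.

Lemma pt_set2 (T : finType) (A B : encType) (F : {set T} -> {set T} -> B) (f g : A -> {set T}) :
  pt f -> pt g -> pt (fun a => F (f a) (g a)).
Proof. by move=> Hf Hg; apply: (pt_setcase (f := fun X a => F X (g a))) Hf => X; apply: pt_set1. Qed.

Lemma esz_sets (T : finType) (s : seq {set T}) N :
  size s <= N -> esz s <= N * (#|{set T}|.*2 + 2) + 1.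
Proof.
move=> le_N; rewrite addn2; apply: esz_seq_bound => //; apply/allP => X _.
have -> : esz X = esz (nat_of_ord (enum_rank X)) by [].
by rewrite esz_nat ltnS leq_double ltnW.
Qed.

Section PolyTime.
Variables (D : finType) (Gam : seq (prel D)).
Notation tp := (tp Gam).
Notation K := (width Gam).

Lemma pt_p2g : pt (@p2g D Gam).
Proof.
rewrite /p2g /anchors; pt_tac.
set A := prod_encType _ _.
(* Relations and coordinates range over fixed finite sets, so both are unfolded into the program. *)
apply: (@pt_natcase A _ (size Gam) (fun i (x : A) =>
    if insub i is Some r then cl_edges x.1.1 x.2 (nth (0, [::]) x.1.2 x.2).2 r else [::])).
- move=> i; case: insub => [r|]; last exact: pt_cst.
  rewrite /cl_edges /anchors; cbv zeta; apply: pt_cat; first by pt_tac.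
  by apply: pt_flatten_static => j; pt_tac.
- by move=> i le_i x; rewrite !insubF // ltnNge ?le_i ?leqnn.
- by rewrite /A; pt_tac.
Qed.

Lemma pt_ac (A : encType) (n : A -> nat) (es : A -> seq (nat * nat)) :
  pt n -> pt es -> pt (fun a => @ac D Gam (n a) (es a)).
Proof.
move=> Hn Hes; have [p Hp] := pt_size Hn.
pose C := #|{set tp}|.*2 + 2.
have le_n a : n a <= pev p (esz a) by have := Hp a; rewrite esz_nat; lia.
(* If there are no edges the fold returns [L] itself, hence the maximum. *)
have size_fold k L t : size (foldl (@ac_step D Gam k) L t) <= maxn k (size L).
  elim: t L => [|e t IH] L /=; first by rewrite leq_maxr.
  by apply: leq_trans (IH _) _; rewrite size_ac_step maxnn leq_maxl.
apply: (pt_iter (n := fun a => n a * #|tp|) (f := fun a L => foldl (@ac_step D Gam (n a)) L (es a))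
  (g := fun a => nseq (n a) setT) (p := PAdd (PMul p (PCst C)) (PCst 1))); pt_tac.
- apply: (pt_foldl (l := fun x : A * seq {set tp} => es x.1)
    (f := fun x => @ac_step D Gam (n x.1)) (g := fun x => x.2)
    (p := PAdd (PMul (PAdd p PX) (PCst C)) (PCst 1))); pt_tac.
  + by apply: pt_comp Hes _; pt_tac.
  + rewrite /ac_step; apply: pt_map; last by apply: pt_iota; apply: pt_comp Hn _; pt_tac.
    apply: pt_set2; last first.
      by apply: pt_if; pt_tac; apply: (pt_set1 (@post D Gam)); rewrite /lab; pt_tac.
    apply: pt_set2; first by rewrite /lab; pt_tac.
    by apply: pt_if; pt_tac; apply: (pt_set1 (@pre D Gam)); rewrite /lab; pt_tac.
  + move=> [a L] k; rewrite /= -/(esz (a, L)).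
    apply: leq_trans (esz_sets (size_fold _ _ _)) _; rewrite leq_add2r leq_mul2r; apply/orP; right.
    rewrite geq_max; apply/andP; split.
      apply: leq_trans (le_n a) (leq_trans (pev_mono p _) (leq_addr _ _)).
      by rewrite esz_pair /=; lia.
    apply: leq_trans (leq_addl _ _); apply: leq_trans (ltnW (esz_size L)) _.
    by rewrite esz_pair /= leqW // leq_addl.
- move=> a k _; apply: leq_trans (esz_sets (leqnn _)) _.
  rewrite leq_add2r leq_mul2r; apply/orP; right; apply: leq_trans (le_n a).
  elim: k => [|k IH]; first by rewrite size_nseq.
  by apply: leq_trans (size_fold _ _ _) _; rewrite geq_max leqnn.
Qed.

Lemma pt_vmerge_all (A : encType) (N : A -> nat) (ps : A -> seq (nat * nat)) :
  pt N -> pt ps -> pt (fun a => vmerge_all (N a) (ps a)).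
Proof.
move=> HN Hps; have [p Hp] := pt_size HN; rewrite /vmerge_all.
apply: (pt_foldl (B := prod_encType nat_encType nat_encType) (C := seq_encType nat_encType)
  (l := ps) (f := fun=> vmerge) (g := fun a => iota 0 (N a))
  (p := PAdd (PMul p (PAdd p (PCst 1))) (PCst 1))); pt_tac.
- by rewrite /vmerge; pt_tac.
- move=> a k; have := Hp a; rewrite esz_nat => le_p; rewrite [pev _ _]/= [pev p _ + 1]addn1.
  have [N0|Npos] := posnP (N a).
    rewrite N0 /=; suff -> : foldl vmerge [::] (take k (ps a)) = [::] by rewrite esz_nil; lia.
    by elim: (take k _).
  apply: esz_seq_bound; first by rewrite size_vmerge size_iota; lia.
  have /allP lt_N : all (gtn (N a)) (foldl vmerge (iota 0 (N a)) (take k (ps a))).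
    by apply: vmerge_lt => //; apply/allP => i; rewrite mem_iota.
  by apply/allP => i /lt_N /= lt_i; rewrite esz_nat; lia.
Qed.

Lemma pt_g2p w0 : pt (@g2p D Gam w0).
Proof.
pose A := prod_encType nat_encType (seq_encType (prod_encType nat_encType nat_encType)).
have HL : pt (fun G : A => @ac D Gam G.1 G.2) by apply: pt_ac; pt_tac.
have Hlab (B : encType) (f : B -> A) (g : B -> nat) : pt f -> pt g ->
    pt (fun b => lab (ac Gam (f b).1 (f b).2) (g b)).
  move=> Hf Hg; rewrite /lab; apply: pt_nth => //; first exact: pt_cst.
  exact: (pt_comp (f := fun G : A => @ac D Gam G.1 G.2)).
have Hm : pt (fun G : A => vmerge_all (G.1 * K) (slot_pairs G.2 (@ac D Gam G.1 G.2))).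
  apply: pt_vmerge_all; first by pt_tac.
  rewrite /slot_pairs; pt_tac.
  by apply: (pt_set2 (@slots D Gam)); apply: (Hlab _ fst); pt_tac.
apply: pt_if.
- apply: pt_has; last by pt_tac.
  by apply: (pt_set1 (fun X : {set tp} => X == set0)); apply: (Hlab _ fst); pt_tac.
- exact: pt_cst.
- apply: pt_comp pt_raw_pcsp _; apply: pt_pair.
    rewrite /g2p_size; apply: pt_if; [|by pt_tac|by pt_tac].
    apply: pt_has; last by pt_tac.
    by apply: (pt_set1 (@needy D Gam)); apply: (Hlab _ fst); pt_tac.
  rewrite /g2p_clauses; apply: pt_flatten; apply: pt_map; last by pt_tac.
  apply: pt_map; last by apply: (pt_set1 (@clause_of D Gam)); apply: (Hlab _ fst); pt_tac.
  apply: pt_pair; first by pt_tac.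
  apply: pt_map; last first.
    apply: pt_iota; apply: (@pt_natcase _ _ (size Gam) (fun i _ => @arity D Gam i)); pt_tac.
      by move=> i; apply: pt_cst.
    by move=> i le_i x; rewrite /arity !insubF // ltnNge ?le_i ?leqnn.
  apply: pt_nth; pt_tac.
  by apply: (pt_comp Hm); pt_tac.
Qed.

Definition pcsp_to_dgh (x : seq bool) : seq bool :=
  let P := parse true x in
  raw_digraph (@p2g D Gam (P.1, [seq (bits_val (size Gam) (head [::] it),
                             [seq bits_val P.1 b | b <- behead it]) | it <- P.2])).

Definition dgh_to_pcsp (w0 : seq bool) (x : seq bool) : seq bool :=
  let P := parse false x in
  @g2p D Gam w0 (P.1, [seq (bits_val P.1 (nth [::] it 0), bits_val P.1 (nth [::] it 1)) | it <- P.2]).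

Lemma pt_pcsp_to_dgh : pt pcsp_to_dgh.
Proof.
apply: (pt_comp pt_raw_digraph); apply: (pt_comp pt_p2g).
have H1 := pt_fst (pt_parse true); have H2 := pt_snd (pt_parse true).
apply: pt_pair => //; apply: pt_map => //; apply: pt_pair.
  by apply: pt_bits_val; pt_tac; apply: pt_head; pt_tac.
by apply: pt_map; pt_tac; apply: pt_bits_val; pt_tac; apply: (pt_comp (pt_parse true)); pt_tac.
Qed.

Lemma pt_dgh_to_pcsp w0 : pt (dgh_to_pcsp w0).
Proof.
apply: (pt_comp (pt_g2p w0)).
have H1 := pt_fst (pt_parse false); have H2 := pt_snd (pt_parse false).
apply: pt_pair => //; apply: pt_map => //.
by apply: pt_pair; apply: pt_bits_val; pt_tac; apply: (pt_comp (pt_parse false)); pt_tac.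
Qed.

Lemma pcsp_to_dghE (I : pcsp_inst Gam) :
  pcsp_to_dgh (enc_pcsp I) = raw_digraph (@p2g D Gam (pi_n I, raw_clauses I)).
Proof.
rewrite /pcsp_to_dgh enc_pcspE parse_pcsp /= -map_comp.
congr (raw_digraph (@p2g D Gam (_, _))); rewrite -[RHS]map_id; apply/eq_in_map => c.
move=> /mapP[[r vs] _ ->] /=; rewrite bits_val_nat 1?ltnW // -map_comp; congr pair.
rewrite -[RHS]map_id; apply/eq_in_map => _ /mapP[x _ ->] /=.
by rewrite bits_val_nat // ltnW.
Qed.

Lemma dgh_to_pcspE w0 (G : in_digraph) :
  dgh_to_pcsp w0 (enc_digraph G) = @g2p D Gam w0 (dg_n G, raw_edges G).
Proof.
rewrite /dgh_to_pcsp enc_digraphE parse_digraph /= -map_comp.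
congr (@g2p D Gam w0 (_, _)); rewrite -[RHS]map_id; apply/eq_in_map => e.
by move=> /mapP[[x y] _ ->] /=; rewrite !bits_val_nat // ltnW.
Qed.

(** The digraph is chosen before [S], so the equivalence can be used with [relP] for YES and with
    [relQ] for NO. *)
Lemma pcsp_to_dgh_spec (I : pcsp_inst Gam) : pcsp_wf I ->
  exists G, pcsp_to_dgh (enc_pcsp I) = enc_digraph G /\
    forall S, dg_hom G (@edge D Gam S) <-> satS S I.
Proof.
move=> wf; have [G nG eG] := raw_digraph_exists (p2g_bound wf).
exists G; rewrite pcsp_to_dghE enc_digraphE nG eG; split=> // S.
split=> [/(dg_hom_raw G _ (v0 Gam))[f]|sat]; rewrite ?eG; first exact: hom_sat.
by apply/(dg_hom_raw G _ (v0 Gam)); rewrite eG; apply: sat_hom.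
Qed.

Lemma dgh_to_pcsp_spec w0 (G : in_digraph) :
  (exists I : pcsp_inst Gam, [/\ dgh_to_pcsp w0 (enc_digraph G) = enc_pcsp I, pcsp_wf I &
    forall S, dg_hom G (@edge D Gam S) <-> satS S I]) \/
  (dgh_to_pcsp w0 (enc_digraph G) = w0 /\ forall S, ~ dg_hom G (@edge D Gam S)).
Proof.
have [I [nI clI wf]] := g2p_inst Gam G; rewrite dgh_to_pcspE /g2p /=.
case: ifPn => [emp|ne]; [right | left].
  split=> // S /(dg_hom_raw G _ (v0 Gam))[f /(g2p_sat nI clI)[]].
  by rewrite emp.
exists I; split=> //; first by rewrite enc_pcspE nI clI.
move=> S; split=> [/(dg_hom_raw G _ (v0 Gam))[f /(g2p_sat nI clI)[]] //|sat].
by apply/(dg_hom_raw G _ (v0 Gam)); apply: sat_g2p nI clI ne sat.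
Qed.
End PolyTime.

(* H = (V, E) is (isomorphic to) a subgraph of H' = (V', E') via the
   injective edge-preserving map iota. *)
Theorem theoremF1 (D : finType) (Gam : seq (prel D)) :
  exists (V : finType) (E : rel V) (V' : finType) (E' : rel V') (iota : V -> V'),
    injective iota /\
    (forall x y, E x y -> E' (iota x) (iota y)) /\
    ptime_equivalent (PCSP Gam) (PDGH E E').
Proof.
(* The word [w0] is a constant of the reduction, so its mere existence is enough. *)
have [[w0 no_w0]|no_no] := classic (exists w, pp_no (PCSP Gam) w).
  exists (vtx Gam), (edge (@relP D Gam)), (vtx Gam), (edge (@relQ D Gam)), id.
  split=> //; split; first exact: edge_sub.
  split.
    exists (@pcsp_to_dgh D Gam); split; first exact/pt_poly_time/pt_pcsp_to_dgh.
    move=> x; split=> -[I [-> [wf sat]]]; have [G [-> HG]] := pcsp_to_dgh_spec wf;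
      exists G; split=> //; first exact/HG.
    by move/HG.
  exists (@dgh_to_pcsp D Gam w0); split; first exact/pt_poly_time/pt_dgh_to_pcsp.
  move=> x; split=> -[G [-> hom]];
    have [[I [-> wf HI]]|[-> none]] := @dgh_to_pcsp_spec D Gam w0 G => //.
  - by exists I; split=> //; split=> //; exact: (proj1 (HI _) hom).
  - by have := none _ hom.
  - by exists I; split=> //; split=> // sat; apply: hom; exact: (proj2 (HI _) sat).
(* Every digraph maps to a loop, so neither problem has NO instances and constant maps to a YES
   instance reduce each to the other. *)
exists unit, (fun _ _ => true), unit, (fun _ _ => true), id; split=> //; split=> //.
pose G0 := @Build_in_digraph 0 [::]; pose I0 := @Build_pcsp_inst D Gam 0 [::].
split.
  exists (fun=> enc_digraph G0); split; first exact/pt_poly_time/pt_cst.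
  move=> x; split=> [_|no]; last by case: no_no; exists x.
  by exists G0; split=> //; exists (fun=> tt).
exists (fun=> enc_pcsp I0); split; first exact/pt_poly_time/pt_cst.
move=> x; split=> [_|[G [_ []]]]; last by exists (fun=> tt).
exists I0; split=> //; split=> //.
by exists (fun i : 'I_0 => False_rect D (notF (ltn_ord i))).
Qed.
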